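(* Let $m,n\geq 2$ be integers with $m\neq n$ and let $\varepsilon_1,\varepsilon_2\in\mathbb{C}$. The affine super Yangian $Y_{\varepsilon_1,\varepsilon_2}(\widehat{\mathfrak{sl}}(m|n))$ is isomorphic to the associative superalgebra over $\mathbb{C}$ generated by $x_{i,r}^{+}, x_{i,r}^{-}, h_{i,r}$ ($i\in\{0,1,\dots,m+n-1\}$, $r=0,1$), where $x^\pm_{m,r}$ and $x^\pm_{0,r}$ are odd and all other generators are even, subject to the following defining relations, in which $\widetilde{h}_{i,1}=h_{i,1}-\frac{\varepsilon_1+\varepsilon_2}{2}h_{i,0}^2$: \begin{gather*} [h_{i,r}, h_{j,s}] = 0\quad (r,s\in\{0,1\}),\\ [x_{i,0}^{+}, x_{j,0}^{-}] = \delta_{i,j} h_{i, 0},\\ [x_{i,1}^{+}, x_{j,0}^{-}] = \delta_{i,j} h_{i, 1} = [x_{i,0}^{+}, x_{j,1}^{-}],\\ [h_{i,0}, x_{j,r}^{\pm}] = \pm a_{i,j} x_{j,r}^{\pm}\quad (r\in\{0,1\}),\\ [\widetilde{h}_{i,1}, x_{j,0}^{\pm}] = \pm a_{i,j}\left(x_{j,1}^{\pm}-b_{i,j}\frac{\varepsilon_1 - \varepsilon_2}{2} x_{j, 0}^{\pm}\right),\\ [x_{i, 1}^{\pm}, x_{j, 0}^{\pm}] - [x_{i, 0}^{\pm}, x_{j, 1}^{\pm}] = \pm a_{i,j}\frac{\varepsilon_1 + \varepsilon_2}{2} \{x_{i, 0}^{\pm}, x_{j, 0}^{\pm}\} - b_{i,j}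 \frac{\varepsilon_1 - \varepsilon_2}{2} [x_{i, 0}^{\pm}, x_{j, 0}^{\pm}],\\ (\mathrm{ad}\, x_{i,0}^{\pm})^{1+|a_{i,j}|} (x_{j,0}^{\pm})= 0 \quad (i \neq j),\\ [x^\pm_{i,0},x^\pm_{i,0}]=0\quad (i=0, m),\\ [[x^\pm_{i-1,0},x^\pm_{i,0}],[x^\pm_{i,0},x^\pm_{i+1,0}]]=0\quad (i=0, m). \end{gather*}
   Context: The index set $\{0,1,\dots,m+n-1\}$ is identified with $\mathbb{Z}/(m+n)\mathbb{Z}$ (so indices $i\pm1$ are read modulo $m+n$). Let $p(i)=0$ for $1\leq i\leq m$, $p(i)=1$ for $m+1\leq i\leq m+n$, and $p(0)=p(m+n)=1$. Set $$a_{i,j}=\begin{cases}(-1)^{p(i)}+(-1)^{p(i+1)}&\text{if } i=j,\\-(-1)^{p(i+1)}&\text{if } j=i+1,\\-(-1)^{p(i)}&\text{if } j=i-1,\\1&\text{if }(i,j)=(0,m+n-1),(m+n-1,0),\\0&\text{otherwise,}\end{cases}\qquad b_{i,j}=\begin{cases}-(-1)^{p(i+1)}&\text{if } i=j-1,\\(-1)^{p(i)}&\text{if } i=j+1,\\-1&\text{if }(i,j)=(0,m+n-1),\\1&\text{if }(i,j)=(m+n-1,0),\\0&\text{otherwise.}\end{cases}$$ (Here in $j=i\pm1$ the indices are integers in $\{0,\dots,m+n-1\}$.) For homogeneous elements $x,y$ of parity $p(x),p(y)$, $[x,y]=xy-(-1)^{p(x)p(y)}yx$ (extended bilinearly), $\mathrm{ad}(x)(y)=[x,y]$,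 and $\{x,y\}=xy+yx$. The affine super Yangian $Y_{\varepsilon_1,\varepsilon_2}(\widehat{\mathfrak{sl}}(m|n))$ is the associative superalgebra over $\mathbb{C}$ generated by $x_{i,r}^{+}, x_{i,r}^{-}, h_{i,r}$ ($i\in\{0,1,\dots,m+n-1\}$, $r\in\mathbb{Z}_{\geq0}$), where $x^\pm_{m,r}$ and $x^\pm_{0,r}$ are odd and all other generators are even, subject to the relations (for all $i,j$ and all $r,s,r_1,r_2,\ldots\in\mathbb{Z}_{\ge0}$) \begin{gather*} [h_{i,r}, h_{j,s}] = 0,\qquad [x_{i,r}^{+}, x_{j,s}^{-}] = \delta_{i,j} h_{i, r+s},\qquad [h_{i,0}, x_{j,r}^{\pm}] = \pm a_{i,j} x_{j,r}^{\pm},\\ [h_{i, r+1}, x_{j, s}^{\pm}] - [h_{i, r}, x_{j, s+1}^{\pm}] = \pm a_{i,j} \tfrac{\varepsilon_1 + \varepsilon_2}{2} \{h_{i, r}, x_{j, s}^{\pm}\} - b_{i,j} \tfrac{\varepsilon_1 - \varepsilon_2}{2} [h_{i, r}, x_{j, s}^{\pm}],\\ [x_{i, r+1}^{\pm}, x_{j, s}^{\pm}] - [x_{i, r}^{\pm}, x_{j, s+1}^{\pm}] = \pm a_{i,j}\tfrac{\varepsilon_1 + \varepsilon_2}{2} \{x_{i, r}^{\pm}, x_{j, s}^{\pm}\} - b_{i,j} \tfrac{\varepsilon_1 - \varepsilon_2}{2} [x_{i, r}^{\pm}, x_{j, s}^{\pm}],\\ \sum_{w \in \mathfrak{S}_{1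 + |a_{i,j}|}}[x_{i,r_{w(1)}}^{\pm}, [x_{i,r_{w(2)}}^{\pm}, \dots, [x_{i,r_{w(1 + |a_{i,j}|)}}^{\pm}, x_{j,s}^{\pm}]\dots]] = 0\ (i \neq j),\\ [x^\pm_{i,r},x^\pm_{i,s}]=0\ (i=0, m),\qquad [[x^\pm_{i-1,r},x^\pm_{i,0}],[x^\pm_{i,0},x^\pm_{i+1,s}]]=0\ (i=0, m). \end{gather*} *)

(* Defs.v *)
From HB Require Import structures.
From mathcomp Require Import all_boot all_algebra perm generic_quotient.
From mathcomp Require Import boolp reals complex.
From mathcomp Require Import finmap monalg.

Set Implicit Arguments.
Unset Strict Implicit.
Unset Printing Implicit Defensive.

Import GRing.Theory.
Local Open Scope ring_scope.
Local Open Scope quotient_scope.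

(* The Z/2-grading is given by its projections: [hcomp p] is the projection
   onto the part of parity p (false = even, true = odd). *)
HB.mixin Record Algebra_isSuperAlgebra (K : pzRingType) A
    of GRing.Algebra K A := {
  hcomp : bool -> A -> A;
  hcomp_linear : forall p (k : K) (x y : A),
    hcomp p (k *: x + y) = k *: hcomp p x + hcomp p y;
  hcomp_sum : forall x : A, hcomp false x + hcomp true x = x;
  hcomp_proj : forall p q (x : A),
    hcomp p (hcomp q x) = if p == q then hcomp q x else 0;
  hcomp_one : hcomp false 1 = 1;
  hcomp_mul : forall p q (x y : A), hcomp p x = x -> hcomp q y = y ->
    hcomp (p (+) q) (x * y) = x * y
}.

#[short(type="superAlgType")]
HB.structure Definition SuperAlgebra (K : pzRingType) :=
  {A of GRing.Algebra K A & Algebra_isSuperAlgebra K A}.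

Section SuperAlgebraTheory.
Context {K : pzRingType}.

Definition superalg_isomorphic (A B : superAlgType K) : Prop :=
  exists f : {lrmorphism A -> B},
    bijective f /\ forall p x, f (hcomp p x) = hcomp p (f x).

Context {A : superAlgType K}.
Implicit Types x y : A.

Definition sbracket x y : A :=
  \sum_(p : bool) \sum_(q : bool)
    (hcomp p x * hcomp q y - (-1) ^+ (p && q) * (hcomp q y * hcomp p x)).

Definition anticomm x y : A := x * y + y * x.

(* The smallest Z/2-graded two-sided ideal containing all u - v with rel u v;
   when the u - v are homogeneous, [gideal_hcomp] adds nothing to the two-sided
   ideal they generate. *)
Inductive graded_ideal (rel : A -> A -> Prop) : A -> Prop :=
| gideal_rel u v : rel u v -> graded_ideal rel (u - v)
| gideal0 : graded_ideal rel 0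
| gidealD u v :
    graded_ideal rel u -> graded_ideal rel v -> graded_ideal rel (u + v)
| gidealM x u y : graded_ideal rel u -> graded_ideal rel (x * u * y)
| gideal_hcomp p u : graded_ideal rel u -> graded_ideal rel (hcomp p u).

Lemma hcompD p x y : hcomp p (x + y) = hcomp p x + hcomp p y.
Proof. by rewrite -[x]scale1r hcomp_linear !scale1r. Qed.

Lemma hcomp0 p : hcomp p (0 : A) = 0.
Proof. by apply: (addIr (hcomp p 0)); rewrite -hcompD !add0r. Qed.

Lemma hcompN p x : hcomp p (- x) = - hcomp p x.
Proof. by rewrite -scaleN1r -[_ *: x]addr0 hcomp_linear hcomp0 addr0 scaleN1r. Qed.

Lemma hcompZ p (k : K) x : hcomp p (k *: x) = k *: hcomp p x.
Proof. by rewrite -[k *: x]addr0 hcomp_linear hcomp0 addr0. Qed.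

Lemma hcomp_homog p q x : hcomp p x = x -> hcomp q x = if q == p then x else 0.
Proof. by move=> px; rewrite -{1}px hcomp_proj px. Qed.

Lemma sbracketE p q x y : hcomp p x = x -> hcomp q y = y ->
  sbracket x y = x * y - (-1) ^+ (p && q) * (y * x).
Proof.
move=> /hcomp_homog px /hcomp_homog qy; rewrite /sbracket.
rewrite (bigD1 p) //= (bigD1 q) //= px qy !eqxx.
rewrite !big1 ?addr0 // => [p' /negbTE np|q' /negbTE nq].
  by rewrite big1 // => q' _; rewrite px np !mul0r !mulr0 subr0.
by rewrite qy nq !(mul0r, mulr0) subr0.
Qed.

Variable rel : A -> A -> Prop.

Lemma gidealMl x u : graded_ideal rel u -> graded_ideal rel (x * u).
Proof. by move=> /(gidealM x 1); rewrite mulr1. Qed.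

Lemma gidealMr u x : graded_ideal rel u -> graded_ideal rel (u * x).
Proof. by move=> /(gidealM 1 x); rewrite mul1r. Qed.

Lemma gidealZ (k : K) u : graded_ideal rel u -> graded_ideal rel (k *: u).
Proof. by move=> /(gidealMl (k *: 1)); rewrite -scalerAl mul1r. Qed.

Lemma gidealN u : graded_ideal rel u -> graded_ideal rel (- u).
Proof. by rewrite -scaleN1r; apply: gidealZ. Qed.

End SuperAlgebraTheory.

Section Augmentation.
Context (K : comNzRingType) (A : superAlgType K).
Context (eps : {lrmorphism A -> K | *%R}).
Hypothesis eps_odd : forall u, eps (hcomp true u) = 0.

Lemma aug_hcomp p u : eps (hcomp p u) = if p then 0 else eps u.
Proof.
by case: p => //; rewrite -[in RHS](hcomp_sum u) rmorphD /= eps_odd addr0.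
Qed.

Lemma aug_sbracket u v : eps u = 0 \/ eps v = 0 -> eps (sbracket u v) = 0.
Proof.
move=> uv0; rewrite /sbracket rmorph_sum big1 // => p _.
rewrite rmorph_sum big1 // => q _; rewrite rmorphB !rmorphM /= !aug_hcomp.
by case: uv0 => ->; rewrite if_same ?mul0r !mulr0 subr0.
Qed.

Lemma aug_anticomm u v : eps u = 0 -> eps (anticomm u v) = 0.
Proof. by move=> u0; rewrite rmorphD !rmorphM /= u0 mul0r mulr0 addr0. Qed.

Lemma aug_proper (rel : A -> A -> Prop) :
  (forall u v, rel u v -> eps u = 0 /\ eps v = 0) -> ~ graded_ideal rel 1.
Proof.
move=> rel0 id1; suff: eps 1 = 0 by rewrite rmorph1; apply/eqP/oner_neq0.
elim: id1 => [u v /rel0[u0 v0]||u v _ u0 _ v0|x u y _ u0|p u _ u0].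
- by rewrite rmorphB /= u0 v0 subrr.
- by rewrite rmorph0.
- by rewrite rmorphD /= u0 v0 addr0.
- by rewrite !rmorphM /= u0 mulr0 mul0r.
- by rewrite aug_hcomp u0 if_same.
Qed.

End Augmentation.

(* The free superalgebra on I, the generator i being of parity [par i]. *)
Definition freeSuper (K : comNzRingType) (I : choiceType) (par : I -> bool)
  : Type := {malg K[{fmonom I}]}.

Section FreeSuper.
Context (K : comNzRingType) (I : choiceType) (par : I -> bool).
Local Notation F := (freeSuper K par).

Definition word_parity (w : {fmonom I}) : bool := foldr addb false (map par w).

HB.instance Definition _ := GRing.Lalgebra.copy F {malg K[{fmonom I}]}.

Definition fgen (i : I) : F := << fmu i >>.

Definition free_hcomp (p : bool) (g : F) : F :=
  [malg w in msupp g => if word_parity w == p then g@_w else 0].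

Lemma free_hcompE p (g : F) w :
  (free_hcomp p g)@_w = if word_parity w == p then g@_w else 0.
Proof.
rewrite /free_hcomp mcoeffE; case: ifP => // /negbT /mcoeff_outdom ->.
by rewrite if_same.
Qed.

Lemma word_parity1 : word_parity mone = false.
Proof. by rewrite /word_parity fm1. Qed.

Lemma word_parityM (v w : {fmonom I}) :
  word_parity (mmul v w) = word_parity v (+) word_parity w.
Proof.
rewrite /word_parity fmM map_cat foldr_cat.
by elim: (v : seq I) => //= i s ->; rewrite addbA.
Qed.

Fact malg_scalerAr (M : monomType) (k : K) (x y : {malg K[M]}) :
  k *: (x * y) = x * (k *: y).
Proof.
apply/malgP => w.
rewrite mcoeffZ (mcoeffMl x y) (mcoeffMlw w (fsubset_refl _) (msuppZ_le k y)).
rewrite mulr_sumr; apply: eq_bigr => v _; rewrite mulr_sumr.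
by apply: eq_bigr => v' _; rewrite mcoeffZ mulrnAr mulrCA.
Qed.

HB.instance Definition _ :=
  GRing.Lalgebra_isAlgebra.Build K F (@malg_scalerAr {fmonom I}).

Fact free_hcomp_linear p (k : K) (x y : F) :
  free_hcomp p (k *: x + y) = k *: free_hcomp p x + free_hcomp p y.
Proof.
apply/malgP => w; rewrite mcoeffD mcoeffZ !free_hcompE mcoeffD mcoeffZ.
by case: ifP; rewrite // mulr0 addr0.
Qed.

Fact free_hcomp_sum (x : F) : free_hcomp false x + free_hcomp true x = x.
Proof.
apply/malgP => w; rewrite mcoeffD !free_hcompE.
by case: word_parity; rewrite ?addr0 ?add0r.
Qed.

Fact free_hcomp_proj p q (x : F) :
  free_hcomp p (free_hcomp q x) = if p == q then free_hcomp q x else 0.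
Proof.
apply/malgP => w; rewrite !free_hcompE.
case: (p =P q) => [->|/eqP npq]; first by rewrite free_hcompE; case: (_ == q).
by rewrite mcoeff0; case: eqP => // ->; rewrite (negbTE npq).
Qed.

Fact free_hcomp_one : free_hcomp false (1 : F) = 1.
Proof.
apply/malgP => w; rewrite free_hcompE !mcoeff1.
by case: (eqVneq w mone) => [->|_]; rewrite ?word_parity1 ?if_same.
Qed.

Fact free_hcomp_mul p q (x y : F) :
  free_hcomp p x = x -> free_hcomp q y = y ->
  free_hcomp (p (+) q) (x * y) = x * y.
Proof.
move=> hx hy; apply/malgP => w; rewrite free_hcompE.
case: ifPn => // nw; apply/esym/eqP; rewrite mcoeff_eq0.
apply: contra nw => /msuppM_le [v [v' [xv yv' ->]]].
have parE r (z : F) u : free_hcomp r z = z -> u \in msupp z -> word_parity u = r.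
  move=> hz; rewrite -mcoeff_neq0 -hz free_hcompE.
  by case: ifP => [/eqP //|_]; rewrite eqxx.
by rewrite word_parityM (parE _ _ _ hx xv) (parE _ _ _ hy yv').
Qed.

HB.instance Definition _ := Algebra_isSuperAlgebra.Build K F
  free_hcomp_linear free_hcomp_sum free_hcomp_proj free_hcomp_one free_hcomp_mul.

Definition counit (u : F) : K := u@_mone.

Fact counit_is_linear : linear_for *%R counit.
Proof. by move=> k u v; rewrite /counit mcoeffD mcoeffZ. Qed.

Fact counit_is_monoid_morphism : monoid_morphism counit.
Proof.
split; first exact: (rmorph1 (@mcoeff {fmonom I} K mone)).
exact: (rmorphM (@mcoeff {fmonom I} K mone)).
Qed.

HB.instance Definition _ :=
  GRing.isLinear.Build K F K *%R counit counit_is_linear.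
HB.instance Definition _ :=
  GRing.isMonoidMorphism.Build F K counit counit_is_monoid_morphism.

Lemma counit_gen i : counit (fgen i) = 0.
Proof.
rewrite /counit /fgen mcoeffU1; case: eqP => // /(congr1 (@fmonom_val I)).
by rewrite fmU fm1.
Qed.

Lemma hcomp_gen p i : hcomp p (fgen i) = if par i == p then fgen i else 0.
Proof.
apply/malgP => w; rewrite [LHS]free_hcompE /fgen mcoeffU1.
case: (eqVneq (fmu i) w) => [<-|/negbTE nw].
  by rewrite /word_parity fmU /= addbF; case: ifP; rewrite ?mcoeffU1 ?eqxx ?mcoeff0.
by rewrite if_same; case: ifP; rewrite ?mcoeffU1 ?nw ?mcoeff0.
Qed.

Lemma counit_odd (u : F) : counit (hcomp true u) = 0.
Proof. by rewrite [LHS]free_hcompE word_parity1. Qed.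

End FreeSuper.

(* The library's algebra structures require 1 != 0, hence the second field. *)
Record relations (K : comNzRingType) (A : superAlgType K) := {
  holds_rel :> A -> A -> Prop;
  relations_proper : ~ graded_ideal holds_rel 1
}.

Section Quotient.
Context (K : comNzRingType) (A : superAlgType K) (P : relations A).

Definition pequiv (x y : A) : bool := `[< graded_ideal P (x - y) >].

Fact pequiv_refl : reflexive pequiv.
Proof. by move=> x; apply/asboolP; rewrite subrr; apply: gideal0. Qed.

Fact pequiv_sym : symmetric pequiv.
Proof.
by move=> x y; apply/asboolP/asboolP => /gidealN; rewrite opprB.
Qed.

Fact pequiv_trans : transitive pequiv.
Proof.
move=> y x z /asboolP xy /asboolP yz; apply/asboolP.
by rewrite -(subrK y x) -addrA; apply: gidealD.
Qed.

Canonical pequiv_equiv := EquivRel pequiv pequiv_refl pequiv_sym pequiv_trans.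

Definition superQuot : Type := {eq_quot pequiv}.
Local Notation Q := superQuot.

HB.instance Definition _ := Choice.on Q.
HB.instance Definition _ := EqQuotient.on Q.

Lemma superQuot_eqP (x y : A) :
  \pi_Q x = \pi_Q y <-> graded_ideal P (x - y).
Proof.
split=> [/eqP|xy]; first by rewrite eqmodE => /asboolP.
by apply/eqP; rewrite eqmodE; apply/asboolP.
Qed.

Fact gideal_repr (x : A) : graded_ideal P (repr (\pi_Q x) - x).
Proof. by apply/superQuot_eqP; rewrite reprK. Qed.

Definition qzero : Q := \pi_Q 0.
Definition qone : Q := \pi_Q 1.
Definition qopp (x : Q) : Q := \pi_Q (- repr x).
Definition qadd (x y : Q) : Q := \pi_Q (repr x + repr y).
Definition qmul (x y : Q) : Q := \pi_Q (repr x * repr y).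
Definition qscale (k : K) (x : Q) : Q := \pi_Q (k *: repr x).
Definition qhcomp (p : bool) (x : Q) : Q := \pi_Q (hcomp p (repr x)).

Fact pi_opp x : qopp (\pi_Q x) = \pi_Q (- x).
Proof. by apply/superQuot_eqP; rewrite -opprD; apply/gidealN/gideal_repr. Qed.

Fact pi_add x y : qadd (\pi_Q x) (\pi_Q y) = \pi_Q (x + y).
Proof.
by apply/superQuot_eqP; rewrite opprD addrACA; apply: gidealD; apply: gideal_repr.
Qed.

Fact pi_mul x y : qmul (\pi_Q x) (\pi_Q y) = \pi_Q (x * y).
Proof.
apply/superQuot_eqP; set x' := repr _; set y' := repr _.
rewrite -(subrK (x' * y) (x' * y')) -addrA -mulrBr -mulrBl; apply: gidealD.
  exact/gidealMl/gideal_repr.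
exact/gidealMr/gideal_repr.
Qed.

Fact pi_scale k x : qscale k (\pi_Q x) = \pi_Q (k *: x).
Proof.
by apply/superQuot_eqP;
  rewrite -scalerBr; apply/gidealZ/gideal_repr.
Qed.

Fact pi_hcomp p x : qhcomp p (\pi_Q x) = \pi_Q (hcomp p x).
Proof.
by apply/superQuot_eqP; rewrite -hcompN -hcompD; apply/gideal_hcomp/gideal_repr.
Qed.

Fact qaddA : associative qadd.
Proof.
by elim/quotW=> x; elim/quotW=> y; elim/quotW=> z;
  rewrite (pi_add x y) (pi_add y z) 2!pi_add addrA.
Qed.
Fact qaddC : commutative qadd.
Proof. by elim/quotW=> x; elim/quotW=> y; rewrite !pi_add addrC. Qed.
Fact qadd0 : left_id qzero qadd.
Proof. by elim/quotW=> x; rewrite pi_add add0r. Qed.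
Fact qaddN : left_inverse qzero qopp qadd.
Proof. by elim/quotW=> x; rewrite pi_opp pi_add addNr. Qed.

HB.instance Definition _ := GRing.isZmodule.Build Q qaddA qaddC qadd0 qaddN.

Fact qmulA : associative qmul.
Proof.
by elim/quotW=> x; elim/quotW=> y; elim/quotW=> z;
  rewrite (pi_mul x y) (pi_mul y z) 2!pi_mul mulrA.
Qed.
Fact qmul1l : left_id qone qmul.
Proof. by elim/quotW=> x; rewrite pi_mul mul1r. Qed.
Fact qmul1r : right_id qone qmul.
Proof. by elim/quotW=> x; rewrite pi_mul mulr1. Qed.
Fact qmulDl : left_distributive qmul qadd.
Proof.
by elim/quotW=> x; elim/quotW=> y; elim/quotW=> z;
  rewrite (pi_add x y) (pi_mul x z) (pi_mul y z) pi_mul pi_add mulrDl.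
Qed.
Fact qmulDr : right_distributive qmul qadd.
Proof.
by elim/quotW=> x; elim/quotW=> y; elim/quotW=> z;
  rewrite (pi_add y z) (pi_mul x y) (pi_mul x z) pi_mul pi_add mulrDr.
Qed.

Fact qone_neq0 : qone != qzero.
Proof.
apply/eqP => /superQuot_eqP; rewrite subr0.
exact: relations_proper.
Qed.

HB.instance Definition _ := GRing.Zmodule_isNzRing.Build Q
  qmulA qmul1l qmul1r qmulDl qmulDr qone_neq0.

Fact qscaleA k l x : qscale k (qscale l x) = qscale (k * l) x.
Proof. by elim/quotW: x => x; rewrite (pi_scale l x) 2!pi_scale scalerA. Qed.
Fact qscale1 : left_id 1 qscale.
Proof. by elim/quotW=> x; rewrite pi_scale scale1r. Qed.
Fact qscaleDr : right_distributive qscale qadd.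
Proof.
by move=> k; elim/quotW=> x; elim/quotW=> y;
  rewrite (pi_add x y) (pi_scale k x) (pi_scale k y) pi_scale pi_add scalerDr.
Qed.
Fact qscaleDl x : {morph qscale^~ x : k l / k + l >-> qadd k l}.
Proof.
by elim/quotW: x => x k l;
  rewrite (pi_scale k x) (pi_scale l x) pi_scale pi_add scalerDl.
Qed.

HB.instance Definition _ := GRing.Zmodule_isLmodule.Build K Q
  qscaleA qscale1 qscaleDr qscaleDl.

Fact qscaleAl k x y : qscale k (qmul x y) = qmul (qscale k x) y.
Proof.
by elim/quotW: x => x; elim/quotW: y => y;
  rewrite (pi_mul x y) (pi_scale k x) pi_mul pi_scale scalerAl.
Qed.
Fact qscaleAr k x y : qscale k (qmul x y) = qmul x (qscale k y).
Proof.
by elim/quotW: x => x; elim/quotW: y => y;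
  rewrite (pi_mul x y) (pi_scale k y) pi_mul pi_scale scalerAr.
Qed.

HB.instance Definition _ := GRing.Lmodule_isLalgebra.Build K Q qscaleAl.
HB.instance Definition _ := GRing.Lalgebra_isAlgebra.Build K Q qscaleAr.

Fact qhcomp_linear p k x y :
  qhcomp p (qadd (qscale k x) y) = qadd (qscale k (qhcomp p x)) (qhcomp p y).
Proof. by elim/quotW: x => x; elim/quotW: y => y; rewrite (pi_scale k x) (pi_add (k *: x) y) (pi_hcomp p x) (pi_hcomp p y) pi_hcomp
  pi_scale pi_add hcomp_linear. Qed.
Fact qhcomp_sum x : qadd (qhcomp false x) (qhcomp true x) = x.
Proof.
by elim/quotW: x => x;
  rewrite (pi_hcomp _ x) (pi_hcomp true x) pi_add hcomp_sum.
Qed.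
Fact qhcomp_proj p q x :
  qhcomp p (qhcomp q x) = if p == q then qhcomp q x else qzero.
Proof.
by elim/quotW: x => x;
  rewrite (pi_hcomp q x) pi_hcomp hcomp_proj; case: ifP.
Qed.
Fact qhcomp_one : qhcomp false qone = qone.
Proof. by rewrite pi_hcomp hcomp_one. Qed.
Fact qhcomp_mul p q x y : qhcomp p x = x -> qhcomp q y = y ->
  qhcomp (p (+) q) (qmul x y) = qmul x y.
Proof.
elim/quotW: x => x; elim/quotW: y => y <- <-; rewrite (pi_hcomp p x) (pi_hcomp q y) pi_mul pi_hcomp.
by rewrite hcomp_mul // hcomp_proj eqxx.
Qed.

HB.instance Definition _ := Algebra_isSuperAlgebra.Build K Q
  qhcomp_linear qhcomp_sum qhcomp_proj qhcomp_one qhcomp_mul.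

End Quotient.

(* x^+_{i,r} is [YX false i r], x^-_{i,r} is [YX true i r], and h_{i,r} is
   [YH i r]. *)
Inductive ygen (N : nat) (L : Type) := YX of bool & 'I_N & L | YH of 'I_N & L.
Arguments YX {N L}.
Arguments YH {N L}.

Section YgenChoice.
Context (N : nat) (L : choiceType).

Definition ygen_code (g : ygen N L) : (bool * 'I_N * L) + ('I_N * L) :=
  match g with YX e i r => inl (e, i, r) | YH i r => inr (i, r) end.

Definition ygen_decode (c : (bool * 'I_N * L) + ('I_N * L)) : ygen N L :=
  match c with inl (e, i, r) => YX e i r | inr (i, r) => YH i r end.

Fact ygen_codeK : cancel ygen_code ygen_decode. Proof. by case. Qed.

HB.instance Definition _ := Choice.copy (ygen N L) (can_type ygen_codeK).

End YgenChoice.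

(* (-1)^{p(k)}; the parity p takes arguments 0 <= k <= m + n, so that p(i + 1)
   for i = m + n - 1 is p(m + n) = 1 = p(0). *)
Definition psign (m k : nat) : int := (-1) ^+ ~~ (1 <= k <= m)%N.

Definition cartan_a (m n : nat) (i j : 'I_(m + n)) : int :=
  if i == j then psign m i + psign m i.+1
  else if j == i.+1 :> nat then - psign m i.+1
  else if i == j.+1 :> nat then - psign m i
  else if (i == 0 :> nat) && (j == (m + n).-1%N :> nat)
       || (i == (m + n).-1%N :> nat) && (j == 0 :> nat) then 1
  else 0.

Definition cartan_b (m n : nat) (i j : 'I_(m + n)) : int :=
  if j == i.+1 :> nat then - psign m i.+1
  else if i == j.+1 :> nat then psign m i
  else if (i == 0 :> nat) && (j == (m + n).-1%N :> nat) then -1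
  else if (i == (m + n).-1%N :> nat) && (j == 0 :> nat) then 1
  else 0.

Definition odd_node (m n : nat) (i : 'I_(m + n)) : bool :=
  (i == 0 :> nat) || (i == m :> nat).

Definition ygen_parity (m n : nat) (L : Type) (g : ygen (m + n) L) : bool :=
  match g with YX _ i _ => odd_node i | YH _ _ => false end.

Section Relations.
Context (K : fieldType) (m n : nat) (eps1 eps2 : K).
Implicit Types (i j : 'I_(m + n)) (e : bool).

Local Notation a i j := ((cartan_a i j)%:~R : K).
Local Notation b i j := ((cartan_b i j)%:~R : K).
Local Notation abs_a i j := (absz (cartan_a i j)).
Local Notation epsD := ((eps1 + eps2) / 2).
Local Notation epsB := ((eps1 - eps2) / 2).
Local Notation "[[ u , v ]]" := (sbracket u v) (format "[[ u ,  v ]]").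
(* the upper sign of +/- is for x^+ (e = false), the lower for x^- (e = true) *)
Local Notation sg e := ((-1) ^+ e : K).

Context (A : superAlgType K).

Inductive yangian_rel (x : bool -> 'I_(m + n) -> nat -> A)
    (h : 'I_(m + n) -> nat -> A) : A -> A -> Prop :=
| yangian_hh i j r s : yangian_rel x h [[h i r, h j s]] 0
| yangian_xx i j r s :
    yangian_rel x h [[x false i r, x true j s]] (h i (r + s)%N *+ (i == j))
| yangian_h0x e i j r :
    yangian_rel x h [[h i 0%N, x e j r]] ((sg e * a i j) *: x e j r)
| yangian_hx e i j r s :
    yangian_rel x h ([[h i r.+1, x e j s]] - [[h i r, x e j s.+1]])
      ((sg e * a i j * epsD) *: anticomm (h i r) (x e j s)
       - (b i j * epsB) *: [[h i r, x e j s]])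
| yangian_xex e i j r s :
    yangian_rel x h ([[x e i r.+1, x e j s]] - [[x e i r, x e j s.+1]])
      ((sg e * a i j * epsD) *: anticomm (x e i r) (x e j s)
       - (b i j * epsB) *: [[x e i r, x e j s]])
| yangian_serre e i j (r : 'I_(1 + abs_a i j) -> nat) s : i != j ->
    yangian_rel x h
      (\sum_(w : 'S_(1 + abs_a i j))
         foldr (fun k y => [[x e i (r (w k)), y]]) (x e j s)
               (enum 'I_(1 + abs_a i j))) 0
| yangian_odd e i r s : odd_node i ->
    yangian_rel x h [[x e i r, x e i s]] 0
| yangian_quartic e i r s : odd_node i ->
    yangian_rel x h
      [[ [[x e (ord_pred i) r, x e i 0%N]],
         [[x e i 0%N, x e (ordS i) s]] ]] 0.

Definition htilde1 (h : 'I_(m + n) -> 'I_2 -> A) (i : 'I_(m + n)) : A :=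
  h i 1 - epsD *: h i 0 ^+ 2.

Inductive minimal_rel (x : bool -> 'I_(m + n) -> 'I_2 -> A)
    (h : 'I_(m + n) -> 'I_2 -> A) : A -> A -> Prop :=
| minimal_hh i j r s : minimal_rel x h [[h i r, h j s]] 0
| minimal_x0x0 i j :
    minimal_rel x h [[x false i 0, x true j 0]] (h i 0 *+ (i == j))
| minimal_x1x0 i j :
    minimal_rel x h [[x false i 1, x true j 0]] (h i 1 *+ (i == j))
| minimal_x0x1 i j :
    minimal_rel x h [[x false i 0, x true j 1]] (h i 1 *+ (i == j))
| minimal_h0x e i j r :
    minimal_rel x h [[h i 0, x e j r]] ((sg e * a i j) *: x e j r)
| minimal_h1x e i j :
    minimal_rel x h [[htilde1 h i, x e j 0]]
      ((sg e * a i j) *: (x e j 1 - (b i j * epsB) *: x e j 0))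
| minimal_xex e i j :
    minimal_rel x h ([[x e i 1, x e j 0]] - [[x e i 0, x e j 1]])
      ((sg e * a i j * epsD) *: anticomm (x e i 0) (x e j 0)
       - (b i j * epsB) *: [[x e i 0, x e j 0]])
| minimal_serre e i j : i != j ->
    minimal_rel x h (iter (1 + abs_a i j) (sbracket (x e i 0)) (x e j 0)) 0
| minimal_odd e i : odd_node i ->
    minimal_rel x h [[x e i 0, x e i 0]] 0
| minimal_quartic e i : odd_node i ->
    minimal_rel x h
      [[ [[x e (ord_pred i) 0, x e i 0]], [[x e i 0, x e (ordS i) 0]] ]] 0.

End Relations.

Section RelationsProper.
Context (K : fieldType) (m n : nat) (eps1 eps2 : K) (A : superAlgType K).
Context (eps : {lrmorphism A -> K | *%R}).
Hypothesis eps_odd : forall u, eps (hcomp true u) = 0.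
Let sb0 := aug_sbracket eps_odd.
Let ac0 := aug_anticomm (eps := eps).
Let epsZ k u : eps (k *: u) = k * eps u. Proof. exact: linearZ. Qed.

Lemma yangian_rel_aug (x : bool -> 'I_(m + n) -> nat -> A) h u v :
  (forall e i r, eps (x e i r) = 0) -> (forall i r, eps (h i r) = 0) ->
  yangian_rel eps1 eps2 x h u v -> eps u = 0 /\ eps v = 0.
Proof.
move=> x0 h0.
have sx e i r w : eps (sbracket (x e i r) w) = 0 by apply: sb0; left.
have sh i r w : eps (sbracket (h i r) w) = 0 by apply: sb0; left.
case=> {u v} [i j r s|i j r s|e i j r|e i j r s|e i j r s|e i j r s _|e i r s _|e i r s _];
  rewrite ?(rmorph0, rmorphMn, rmorphB) /= ?epsZ ?(sx, sh, x0, h0) ?mul0rn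
    ?mulr0 ?subr0 ?ac0 ?mulr0 //; split=> //;
  rewrite ?mulr0 ?subr0 //.
  rewrite rmorph_sum big1 // => w _.
  by case: (enum _) => [|k t] /=; rewrite ?x0 ?sx.
by apply: sb0; left.
Qed.

Lemma minimal_rel_aug (x : bool -> 'I_(m + n) -> 'I_2 -> A) h u v :
  (forall e i r, eps (x e i r) = 0) -> (forall i r, eps (h i r) = 0) ->
  minimal_rel eps1 eps2 x h u v -> eps u = 0 /\ eps v = 0.
Proof.
move=> x0 h0.
have sx e i r w : eps (sbracket (x e i r) w) = 0 by apply: sb0; left.
have sh i r w : eps (sbracket (h i r) w) = 0 by apply: sb0; left.
case=> {u v} [i j r s|i j|i j|i j|e i j r|e i j|e i j|e i j _|e i _|e i _];
  rewrite ?(rmorph0, rmorphMn, rmorphB) /= ?epsZ ?(sx, sh, x0, h0) ?mul0rn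
    ?mulr0 ?subr0 ?ac0 ?mulr0 //; split=> //;
  rewrite ?mulr0 ?subr0 //.
- by apply: sb0; right.
- by rewrite rmorphB /= epsZ !x0 mulr0 subr0 mulr0.
- by apply: sb0; left.
Qed.

End RelationsProper.

Section Yangian.
Context (K : fieldType) (m n : nat) (eps1 eps2 : K).

Section Generators.
Context (L : choiceType).
Local Notation F := (freeSuper K (@ygen_parity m n L)).
Definition gen_x e i (r : L) : F := fgen K (@ygen_parity m n L) (YX e i r).
Definition gen_h i (r : L) : F := fgen K (@ygen_parity m n L) (YH i r).
End Generators.

Definition yangian_relations : relations (freeSuper K (@ygen_parity m n nat)) :=
  Build_relations (aug_proper (@counit_odd _ _ _) (fun u v =>
    @yangian_rel_aug K m n eps1 eps2 _ _ (@counit_odd _ _ _)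
      (@gen_x nat) (@gen_h nat) u v
      (fun e i r => counit_gen _ _ _) (fun i r => counit_gen _ _ _))).

Definition minimal_relations : relations (freeSuper K (@ygen_parity m n 'I_2)) :=
  Build_relations (aug_proper (@counit_odd _ _ _) (fun u v =>
    @minimal_rel_aug K m n eps1 eps2 _ _ (@counit_odd _ _ _)
      (@gen_x 'I_2) (@gen_h 'I_2) u v
      (fun e i r => counit_gen _ _ _) (fun i r => counit_gen _ _ _))).

Definition affine_super_yangian : superAlgType K := superQuot yangian_relations.
Definition minimal_super_yangian : superAlgType K := superQuot minimal_relations.

End Yangian.

(* Main.v *)
Require Import Defs.
From HB Require Import structures.
From mathcomp Require Import all_boot all_algebra perm generic_quotient.
From mathcomp Require Import boolp reals complex finmap monalg zify ring.

(** Write x_{i,r} for x^+_{i,r} or x^-_{i,r}, the sign +-1 being that of the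
    exponent, and h~_{i,1} for [htilde1].  The isomorphism is the identity on
    the generators of degree r = 0, 1.  It exists, and is bijective, because of
    three facts about families of elements of an arbitrary superalgebra.

    - A family satisfying the relations of the affine super Yangian satisfies
      the minimal relations in degrees 0 and 1 ([yangian_minimal]).
    - It is determined by these degrees ([yangian_family_unique]): in it,
      [h~_{i,1}, x_{j,r}] = +- a_ij (x_{j,r+1} - b_ij (eps1 - eps2)/2 x_{j,r}),
      and every node j has a neighbour i, for which a_ij is invertible.
    - Every family satisfying the minimal relations extends to one satisfying
      all relations ([minimal_extends]).  This is the substance of the theorem.

    For the extension, let m <> n.  Then the affine Cartan matrix has corank one
    and its image consists of all vectors whose entries sum to zero
    ([cartan_image]).  Hence for p, q with zero sums the span of the h~_{i,1}
    and h_{i,0} contains an element t with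
    [t, x_{j,0}] = +- (p_j x_{j,1} + q_j x_{j,0}) for all j
    ([shifts_exists]).  These elements commute with one another.  Iterating
    one of them with p_j = 1 defines x_{j,r}, and then t maps x_{j,r} to
    +- (p_j x_{j,r+1} + q_j x_{j,r}) for every t.  As the cycle has at least
    five nodes, the sum of p can be balanced on a node that a given relation
    does not involve.  So, in a relation between different nodes, the degree
    can be raised at each node separately, and the relation follows from its
    instance in degree zero.

    What remains are the relations in which a node occurs twice.

    - The bracket of x^+_{j,p} and x^-_{j,q} must depend on p + q only
      ([by_degree_all]).  If this holds for p + q <= k, then in degree k + 1
      these brackets form an arithmetic progression with difference
      d_j = [t, h_{j,k}].  For adjacent nodes i and j the commutator
      [h_{i,k}, h_{j,1}] can be computed from the action of h_{i,k} on the
      x_j and from that of h_{j,1} on the x_i; the comparison is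
      k d_j + d_i = 0.  Exchanging i and j, (k^2 - 1) d_j = 0, so that d_j = 0
      for k >= 2; degrees one and two are covered by the minimal relations.
    - A relation symmetric in x_{i,r} and x_{i,s}, such as the Serre relation,
      is raised by t only through the power sum p_1 of two variables.  The
      degree-two coefficient of log (1 + (eps1 + eps2) sum_r h_{k,r} z^(-r-1))
      for a neighbour k of i raises it through p_2, up to terms of lower degree
      that can be removed ([raise_two]).  Since p_1
      and p_2 generate the symmetric polynomials in two variables, this
      suffices ([symmetric_vanish]).
    - The relation between h_{i,r} and x_{i,s} is known for r = 0; taking the
      bracket of the relation of x_{i,r} and x_{i,s} with the opposite
      generator shows that its defect is antisymmetric in r and s
      ([hx_diag]).
    - The h_{i,r} commute by the computation of the first point, which now
      applies in all degrees and to all pairs of nodes ([hcur_comm]). *)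

Set Implicit Arguments.
Unset Strict Implicit.
Unset Printing Implicit Defensive.

Import GRing.Theory Num.Theory.
Local Open Scope ring_scope.
Local Open Scope quotient_scope.

(** * Normalization in noncommutative algebras *)

(** Equations in a noncommutative algebra A over a commutative ring K are
    decided by reflection: an expression becomes a list of words in its atoms
    with coefficients in K, so that an equation in A reduces to one equation
    in K for each word.  The coefficients stay symbolic and are left to the
    procedures for commutative rings. *)
Section NcNormal.
Context (K : comNzRingType) (A : algType K).

Inductive ncexp :=
  | NcVar of nat | NcZero | NcOne | NcAdd of ncexp & ncexp | NcOpp of ncexp
  | NcMul of ncexp & ncexp | NcScale of K & ncexp.

Fixpoint nc_atom (env : seq A) (n : nat) : A :=
  match env, n with
  | [::], _ => 0
  | u :: _, 0%N => u
  | _ :: env', S n' => nc_atom env' n'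
  end.

Fixpoint nc_eval (env : seq A) (e : ncexp) : A :=
  match e with
  | NcVar n => nc_atom env n
  | NcZero => 0
  | NcOne => 1
  | NcAdd e1 e2 => nc_eval env e1 + nc_eval env e2
  | NcOpp e1 => - nc_eval env e1
  | NcMul e1 e2 => nc_eval env e1 * nc_eval env e2
  | NcScale k e1 => k *: nc_eval env e1
  end.

Fixpoint nc_cat T (s t : seq T) : seq T :=
  match s with [::] => t | u :: s' => u :: nc_cat s' t end.

Fixpoint nc_map S T (f : S -> T) (s : seq S) : seq T :=
  match s with [::] => [::] | u :: s' => f u :: nc_map f s' end.

Fixpoint nc_mul (s t : seq (K * seq nat)) : seq (K * seq nat) :=
  match s with
  | [::] => [::]
  | (k, v) :: s' =>
      nc_cat (nc_map (fun lw => (k * lw.1, nc_cat v lw.2)) t) (nc_mul s' t)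
  end.

Fixpoint nc_norm (e : ncexp) : seq (K * seq nat) :=
  match e with
  | NcVar n => [:: (1, [:: n])]
  | NcZero => [::]
  | NcOne => [:: (1, [::])]
  | NcAdd e1 e2 => nc_cat (nc_norm e1) (nc_norm e2)
  | NcOpp e1 => nc_map (fun lw => (- lw.1, lw.2)) (nc_norm e1)
  | NcMul e1 e2 => nc_mul (nc_norm e1) (nc_norm e2)
  | NcScale k e1 => nc_map (fun lw => (k * lw.1, lw.2)) (nc_norm e1)
  end.

Fixpoint nc_eqnat (a b : nat) : bool :=
  match a, b with
  | 0%N, 0%N => true | S a', S b' => nc_eqnat a' b' | _, _ => false
  end.

Fixpoint nc_eqword (v w : seq nat) : bool :=
  match v, w with
  | [::], [::] => true
  | a :: v', b :: w' => if nc_eqnat a b then nc_eqword v' w' else false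
  | _, _ => false
  end.

Fixpoint nc_collect (k : K) (w : seq nat) (s : seq (K * seq nat)) :=
  match s with
  | [::] => [:: (k, w)]
  | (l, v) :: s' =>
      if nc_eqword v w then (l + k, v) :: s' else (l, v) :: nc_collect k w s'
  end.

Fixpoint nc_gather (s : seq (K * seq nat)) :=
  match s with
  | [::] => [::]
  | (k, w) :: s' => nc_collect k w (nc_gather s')
  end.

Fixpoint nc_all0 (s : seq (K * seq nat)) : Prop :=
  match s with [::] => True | (k, _) :: s' => k = 0 /\ nc_all0 s' end.

Definition nc_check (e1 e2 : ncexp) : Prop :=
  nc_all0 (nc_gather (nc_norm (NcAdd e1 (NcOpp e2)))).

Fixpoint nc_word (env : seq A) (w : seq nat) : A :=
  match w with [::] => 1 | n :: w' => nc_atom env n * nc_word env w' end.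

Fixpoint nc_sum (env : seq A) (s : seq (K * seq nat)) : A :=
  match s with
  | [::] => 0 | (k, w) :: s' => k *: nc_word env w + nc_sum env s'
  end.

Variable env : seq A.

Lemma nc_wordM v w : nc_word env (nc_cat v w) = nc_word env v * nc_word env w.
Proof. by elim: v => [|a v IH] /=; rewrite ?mul1r // IH mulrA. Qed.

Lemma nc_sumD s t : nc_sum env (nc_cat s t) = nc_sum env s + nc_sum env t.
Proof. by elim: s => [|[k w] s IH] /=; rewrite ?add0r // IH addrA. Qed.

Lemma nc_sumZ k s :
  nc_sum env (nc_map (fun lw => (k * lw.1, lw.2)) s) = k *: nc_sum env s.
Proof.
by elim: s => [|[l w] s IH] /=; rewrite ?scaler0 // IH scalerDr scalerA.
Qed.

Lemma nc_sumN s :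
  nc_sum env (nc_map (fun lw => (- lw.1, lw.2)) s) = - nc_sum env s.
Proof.
by elim: s => [|[l w] s IH] /=; rewrite ?oppr0 // IH opprD scaleNr.
Qed.

Lemma nc_sumM s t : nc_sum env (nc_mul s t) = nc_sum env s * nc_sum env t.
Proof.
elim: s => [|[k v] s IH] /=; rewrite ?mul0r // nc_sumD IH mulrDl; congr (_ + _).
elim: t {IH} => [|[l w] t IHt] /=; rewrite ?mulr0 // IHt mulrDr nc_wordM.
by congr (_ + _); rewrite -scalerAl -scalerAr scalerA.
Qed.

Lemma nc_normP e : nc_sum env (nc_norm e) = nc_eval env e.
Proof.
elim: e => [n|||e1 IH1 e2 IH2|e IH|e1 IH1 e2 IH2|k e IH] /=.
- by rewrite scale1r mulr1 addr0.
- by [].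
- by rewrite scale1r addr0.
- by rewrite nc_sumD IH1 IH2.
- by rewrite nc_sumN IH.
- by rewrite nc_sumM IH1 IH2.
- by rewrite nc_sumZ IH.
Qed.

Lemma nc_eqwordP v w : nc_eqword v w -> v = w.
Proof.
elim: v w => [|a v IH] [|b w] //=.
have eqP' : nc_eqnat a b -> a = b.
  by elim: a b => [|a IHa] [|b] //= /IHa ->.
by case: ifP => // /eqP' -> /IH ->.
Qed.

Lemma nc_collectP k w s :
  nc_sum env (nc_collect k w s) = k *: nc_word env w + nc_sum env s.
Proof.
elim: s => [|[l v] s IH] //=; case: ifP => [/nc_eqwordP -> /=|_ /=].
  by rewrite scalerDl addrCA addrA.
by rewrite IH addrCA.
Qed.

Lemma nc_gatherP s : nc_sum env (nc_gather s) = nc_sum env s.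
Proof. by elim: s => [|[k w] s IH] //=; rewrite nc_collectP IH. Qed.

Lemma nc_all0P s : nc_all0 s -> nc_sum env s = 0.
Proof. by elim: s => [|[k w] s IH] //= [-> /IH ->]; rewrite scale0r addr0. Qed.

Lemma nc_ringP e1 e2 : nc_check e1 e2 -> nc_eval env e1 = nc_eval env e2.
Proof.
move=> /nc_all0P; rewrite nc_gatherP nc_normP /= => /eqP.
by rewrite subr_eq0 => /eqP.
Qed.

End NcNormal.

(** Atoms are compared up to conversion, since the same bracket may be
    elaborated through different paths of the algebraic hierarchy. *)
Ltac nc_index x env :=
  lazymatch env with
  | nil => constr:(@None nat)
  | ?y :: ?env' =>
      match goal with
      | _ => let _ := match goal with _ => unify x y end in constr:(Some O)
      | _ => lazymatch nc_index x env' with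
             | Some ?n => constr:(Some (S n)) | None => constr:(@None nat) end
      end
  end.

Ltac nc_atoms env t :=
  lazymatch t with
  | 0%R => env
  | 1%R => env
  | (?x + ?y)%R => let env1 := nc_atoms env x in nc_atoms env1 y
  | (- ?x)%R => nc_atoms env x
  | (?x * ?y)%R => let env1 := nc_atoms env x in nc_atoms env1 y
  | (?k *: ?x)%R => nc_atoms env x
  | ?x => lazymatch nc_index x env with
          | None => constr:(x :: env) | Some _ => env end
  end.

Ltac nc_reify K env t :=
  lazymatch t with
  | 0%R => constr:(@NcZero K)
  | 1%R => constr:(@NcOne K)
  | (?x + ?y)%R => let a := nc_reify K env x in let b := nc_reify K env y in
      constr:(@NcAdd K a b)
  | (- ?x)%R => let a := nc_reify K env x in constr:(@NcOpp K a)
  | (?x * ?y)%R => let a := nc_reify K env x in let b := nc_reify K env y in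
      constr:(@NcMul K a b)
  | (?k *: ?x)%R => let a := nc_reify K env x in constr:(@NcScale K k a)
  | ?x => lazymatch nc_index x env with Some ?n => constr:(@NcVar K n) end
  end.

(** The normal form is computed without unfolding the operations of K, so
    that the resulting coefficients are readable for [ring] and [field]. *)
Ltac nc_prep K A :=
  lazymatch goal with |- ?u = ?v =>
    let env0 := nc_atoms (@nil (GRing.Algebra.sort A)) u in
    let env := nc_atoms env0 v in
    let e1 := nc_reify K env u in
    let e2 := nc_reify K env v in
    refine (@nc_ringP K A env e1 e2 _);
    cbv beta iota delta [nc_check nc_norm nc_gather nc_collect nc_eqword
      nc_eqnat nc_all0 nc_cat nc_map nc_mul fst snd];
    repeat split
  end.
Ltac nc_ring K A := nc_prep K A; ring.

(** * Universal properties of free superalgebras and their quotients *)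

Section FreeUniversal.
Context (K : comNzRingType) (I : choiceType) (par : I -> bool).
Context (A : superAlgType K) (v : I -> A).
Hypothesis v_par : forall i, hcomp (par i) (v i) = v i.
Local Notation F := (freeSuper K par).

Definition free_word (w : {fmonom I}) : A := \prod_(i <- (w : seq I)) v i.

Definition free_ext (g : F) : A :=
  \sum_(w <- msupp (g : {malg K[{fmonom I}]})) g@_w *: free_word w.

Lemma free_extEw (d : {fset {fmonom I}}) (g : F) :
  (msupp (g : {malg K[{fmonom I}]}) `<=` d)%fset ->
  free_ext g = \sum_(w <- d) g@_w *: free_word w.
Proof.
move=> le; rewrite [LHS](big_fset_incl _ le) => //= w wd /mcoeff_outdom ->.
by rewrite scale0r.
Qed.

Fact free_ext_is_linear : linear free_ext.
Proof.
move=> k g1 g2; pose d := (msupp (g1 : {malg K[{fmonom I}]}) `|` msupp (g2 :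
  {malg K[{fmonom I}]}))%fset.
rewrite !(@free_extEw d); first last.
- rewrite /d; apply/fsubsetP => w; rewrite -!mcoeff_neq0 in_fsetU -!mcoeff_neq0.
  rewrite mcoeffD mcoeffZ; apply: contraNT; rewrite negb_or !negbK.
  by case/andP => /eqP -> /eqP ->; rewrite mulr0 addr0.
- exact: fsubsetUl.
- exact: fsubsetUr.
rewrite scaler_sumr -big_split; apply: eq_bigr => w _ /=.
by rewrite mcoeffD mcoeffZ scalerDl scalerA.
Qed.
HB.instance Definition _ := GRing.isLinear.Build K F A *:%R free_ext
  free_ext_is_linear.

Lemma free_extU k (w : {fmonom I}) : free_ext << k *g w >> = k *: free_word w.
Proof. by rewrite (free_extEw msuppU_le) big_seq_fset1 mcoeffUU. Qed.

Lemma free_ext_gen i : free_ext (fgen K par i) = v i.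
Proof. by rewrite free_extU scale1r /free_word fmU big_seq1. Qed.

Lemma free_wordM (w1 w2 : {fmonom I}) :
  free_word (mmul w1 w2) = free_word w1 * free_word w2.
Proof. by rewrite /free_word fmM big_cat. Qed.

Fact free_ext_is_monoid_morphism : monoid_morphism free_ext.
Proof.
split=> [|g1 g2].
  have -> : (1 : F) = << 1 *g mone >> by [].
  by rewrite free_extU /free_word fm1 big_nil scale1r.
rewrite [in LHS]malgME raddf_sum mulr_suml; apply: eq_bigr => w1 _.
rewrite raddf_sum mulr_sumr; apply: eq_bigr => w2 _.
by rewrite /= free_extU free_wordM -scalerAl -scalerAr scalerA.
Qed.
HB.instance Definition _ := GRing.isMonoidMorphism.Build F A free_ext
  free_ext_is_monoid_morphism.

Lemma hcomp_free_word p (w : {fmonom I}) :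
  hcomp p (free_word w) = if word_parity par w == p then free_word w else 0.
Proof.
suff h : hcomp (word_parity par w) (free_word w) = free_word w.
  by rewrite -[in LHS]h hcomp_proj h eq_sym.
rewrite /free_word /word_parity; elim: (w : seq I) => [|i s IH] /=.
  by rewrite big_nil hcomp_one.
by rewrite big_cons hcomp_mul.
Qed.

Lemma hcomp_sumr (B : superAlgType K) p (J : Type) (r : seq J) (P : pred J) (f :
  J -> B) :
  hcomp p (\sum_(j <- r | P j) f j) = \sum_(j <- r | P j) hcomp p (f j).
Proof. exact: (big_morph _ (@hcompD K B p) (@hcomp0 K B p)). Qed.

Lemma free_ext_hcomp p (g : F) : free_ext (hcomp p g) = hcomp p (free_ext g).
Proof.
rewrite (@free_extEw (msupp (g : {malg K[{fmonom I}]}))); last first.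
  apply/fsubsetP => w; rewrite -!mcoeff_neq0 free_hcompE.
  by case: ifP => //; rewrite eqxx.
rewrite hcomp_sumr; apply: eq_bigr => w _.
rewrite hcompZ hcomp_free_word free_hcompE.
by case: ifP; rewrite ?scale0r ?scaler0.
Qed.

Lemma free_universal : exists f : {lrmorphism F -> A},
  (forall i, f (fgen K par i) = v i) /\ (forall p u,
    f (hcomp p u) = hcomp p (f u)).
Proof.
exists free_ext; split; [exact: free_ext_gen | exact: free_ext_hcomp].
Qed.

End FreeUniversal.

Lemma free_ind (K : comNzRingType) (I : choiceType) (par : I -> bool)
    (P : freeSuper K par -> Prop) :
  P 1 -> (forall k u v, P u -> P v -> P (k *: u + v)) ->
  (forall u v, P u -> P v -> P (u * v)) -> (forall i, P (fgen K par i)) ->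
  forall u, P u.
Proof.
move=> P1 Plin PM Pg u.
have P0 : P 0 by rewrite -(addNr 1) -scaleN1r; apply: Plin.
have Pw (s : seq I) : P << fmonom_of_seq fmonom_key s >>.
  elim: s => [//|i s IH].
  have <- : mmul (fmu i) (fmonom_of_seq fmonom_key s)
            = fmonom_of_seq fmonom_key (i :: s).
    by apply: val_inj; rewrite /= fmM fmU !fmE.
  have -> : << mmul (fmu i) (fmonom_of_seq fmonom_key s) >>
            = fgen K par i * << fmonom_of_seq fmonom_key s >>.
    by rewrite /fgen malgM_def fgmulUU mulr1.
  exact: PM.
rewrite (monalgE u); elim/big_rec: _ => // w v _ Pv.
have -> : << u@_w *g w >> = u@_w *: (<< w >> : freeSuper K par).
  by apply/malgP => w'; rewrite mcoeffZ !mcoeffU mulrnAr mulr1.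
have -> : w = fmonom_of_seq fmonom_key w by apply: val_inj; rewrite /= fmE.
exact: Plin.
Qed.

Section QuotientUniversal.
Context (K : comNzRingType) (A B : superAlgType K) (P : relations A).
Context (f : {lrmorphism A -> B}).
Hypothesis f_hcomp : forall p u, f (hcomp p u) = hcomp p (f u).
Hypothesis f_rel : forall u v, P u v -> f u = f v.

Lemma quot_ext_ideal u : graded_ideal P u -> f u = 0.
Proof.
elim=> {u} [u v /f_rel uv||u v _ u0 _ v0|x u y _ u0|p u _ u0].
- by rewrite rmorphB /= uv subrr.
- exact: rmorph0.
- by rewrite rmorphD /= u0 v0 addr0.
- by rewrite !rmorphM /= u0 mulr0 mul0r.
- by rewrite f_hcomp u0 hcomp0.
Qed.

Definition quot_ext (q : superQuot P) : B := f (repr q).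

Lemma quot_ext_pi u : quot_ext (\pi_(superQuot P) u) = f u.
Proof.
by apply/eqP; rewrite -subr_eq0 -rmorphB; apply/eqP/quot_ext_ideal/gideal_repr.
Qed.

Fact quot_ext_is_linear : linear quot_ext.
Proof.
move=> k; elim/quotW=> u; elim/quotW=> v.
rewrite [k *: _]Defs.pi_scale [X in quot_ext X]Defs.pi_add !quot_ext_pi.
by rewrite rmorphD /= linearZ.
Qed.
HB.instance Definition _ := GRing.isLinear.Build K (superQuot P) B *:%R quot_ext
  quot_ext_is_linear.

Fact quot_ext_is_monoid_morphism : monoid_morphism quot_ext.
Proof.
split=> [|]; first by rewrite [LHS]quot_ext_pi rmorph1.
elim/quotW=> u; elim/quotW=> v.
by rewrite [X in quot_ext X]Defs.pi_mul !quot_ext_pi rmorphM.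
Qed.
HB.instance Definition _ := GRing.isMonoidMorphism.Build (superQuot P) B
  quot_ext
  quot_ext_is_monoid_morphism.

Lemma quot_ext_hcomp p q : quot_ext (hcomp p q) = hcomp p (quot_ext q).
Proof.
by elim/quotW: q => u; rewrite [X in quot_ext X]Defs.pi_hcomp !quot_ext_pi
  f_hcomp.
Qed.

Lemma quot_universal : exists g : {lrmorphism superQuot P -> B},
  (forall u, g (\pi_(superQuot P) u) = f u)
  /\ (forall p q, g (hcomp p q) = hcomp p (g q)).
Proof.
exists quot_ext; split; [exact: quot_ext_pi | exact: quot_ext_hcomp].
Qed.

End QuotientUniversal.

Section QuotientProjection.
Context (K : comNzRingType) (A : superAlgType K) (P : relations A).

Definition quot_pi (u : A) : superQuot P := \pi_(superQuot P) u.

Fact quot_pi_is_linear : linear quot_pi.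
Proof. by move=> k u v; rewrite /quot_pi -Defs.pi_add -Defs.pi_scale. Qed.
HB.instance Definition _ := GRing.isLinear.Build K A (superQuot P) *:%R quot_pi
  quot_pi_is_linear.

Fact quot_pi_is_monoid_morphism : monoid_morphism quot_pi.
Proof. by split=> [|u v] //; rewrite /quot_pi -Defs.pi_mul. Qed.
HB.instance Definition _ := GRing.isMonoidMorphism.Build A (superQuot P) quot_pi
  quot_pi_is_monoid_morphism.

Lemma quot_pi_hcomp p u : quot_pi (hcomp p u) = hcomp p (quot_pi u).
Proof. by rewrite /quot_pi -Defs.pi_hcomp. Qed.

Lemma quot_pi_rel u v : P u v -> quot_pi u = quot_pi v.
Proof. by move=> uv; apply/superQuot_eqP/gideal_rel. Qed.

End QuotientProjection.

(** * The affine Cartan matrix *)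

Section Cycle.
Context (m n : nat).
Hypotheses (hm : (2 <= m)%N) (hn : (2 <= n)%N).
Implicit Types i j k : 'I_(m + n).

Lemma eq_ordS i j :
  (i == ordS j) = (i == (if j.+1 == m + n then 0 else j.+1)%N :> nat).
Proof.
rewrite -(inj_eq val_inj) /=; congr (_ == _); case: eqP => [->|ne].
  by rewrite modnn.
by rewrite modn_small //; have := ltn_ord j; lia.
Qed.

Lemma eq_ord_pred i j : (i == ord_pred j) = (j == ordS i).
Proof. by apply/eqP/eqP => ->; rewrite ?ord_predK ?ordSK. Qed.

Lemma ordS_neq i : (ordS i == i) = false.
Proof. by rewrite eq_sym eq_ordS; have := ltn_ord i; case: ifP; lia. Qed.

Lemma ordSS_neq i : (ordS (ordS i) == i) = false.
Proof.
rewrite eq_sym eq_ordS.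
have := eq_ordS (ordS i) i; rewrite eqxx => /esym/eqP ->.
by have := ltn_ord i; case: ifP; case: ifP; lia.
Qed.

Lemma ordSSS_neq i : (ordS (ordS (ordS i)) == i) = false.
Proof.
rewrite eq_sym eq_ordS.
have := eq_ordS (ordS (ordS i)) (ordS i); rewrite eqxx => /esym/eqP ->.
have := eq_ordS (ordS i) i; rewrite eqxx => /esym/eqP ->.
by have := ltn_ord i; case: ifP; case: ifP; case: ifP; lia.
Qed.

Lemma psignS i : psign m (ordS i) = psign m i.+1.
Proof.
have := eq_ordS (ordS i) i; rewrite eqxx => /esym/eqP ->.
case: eqP => // ->; rewrite /psign.
by have -> : (1 <= m + n <= m)%N = false by lia.
Qed.

Lemma psign_nodes i j : [/\ (i == j.+1 :> nat)%N -> psign m i = psign m j.+1,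
  (i == 0 :> nat)%N -> psign m i = -1 & (i.+1 == m + n)%N -> psign m i.+1 = -1].
Proof.
split=> /eqP -> //; rewrite /psign.
by have -> : (1 <= m + n <= m)%N = false by lia.
Qed.

(** This form is invariant under the rotation of the cycle: the wrap-around
    entries follow the same rule as the others because psign takes the same
    value at the nodes 0 and m + n. *)
Lemma cartan_aE i j : cartan_a i j =
  (psign m i + psign m (ordS i)) *+ (i == j)
  - psign m j *+ (j == ordS i) - psign m i *+ (i == ordS j).
Proof.
rewrite /cartan_a psignS !eq_ordS -(inj_eq val_inj) /=.
have [ltiN ltjN] := (ltn_ord i, ltn_ord j).
have [a1 a2 a3] := psign_nodes i j; have [b1 b2 b3] := psign_nodes j i.
move: (psign m i) (psign m j) (psign m i.+1) (psign m j.+1) a1 a2 a3 b1 b2 b3.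
move=> pi pj pi' pj'.
by repeat case: eqP => /= ?; lia.
Qed.

Lemma cartan_bE i j : cartan_b i j =
  psign m i *+ (i == ordS j) - psign m j *+ (j == ordS i).
Proof.
rewrite /cartan_b !eq_ordS.
have [ltiN ltjN] := (ltn_ord i, ltn_ord j).
have [a1 a2 a3] := psign_nodes i j; have [b1 b2 b3] := psign_nodes j i.
move: (psign m i) (psign m j) (psign m i.+1) (psign m j.+1) a1 a2 a3 b1 b2 b3.
move=> pi pj pi' pj'.
by repeat case: eqP => /= ?; lia.
Qed.

Lemma psign_sqr k : psign m k * psign m k = 1.
Proof. by rewrite -expr2 /psign sqrr_sign. Qed.

Lemma cartan_aC i j : cartan_a i j = cartan_a j i.
Proof.
rewrite !cartan_aE eq_sym addrAC; case: eqP => [->|_]; first by rewrite addrAC.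
by rewrite addrAC.
Qed.

Lemma cartan_a_self i : cartan_a i i = psign m i + psign m (ordS i).
Proof. by rewrite cartan_aE eqxx eq_sym ordS_neq !subr0. Qed.

Lemma cartan_b_self i : cartan_b i i = 0.
Proof. by rewrite cartan_bE eq_sym ordS_neq subr0. Qed.

Lemma cartan_a_next i : cartan_a i (ordS i) = - psign m (ordS i).
Proof.
by rewrite cartan_aE eqxx 2!(eq_sym i) ordS_neq ordSS_neq !mulr0n sub0r subr0.
Qed.

Lemma cartan_b_next i : cartan_b i (ordS i) = - psign m (ordS i).
Proof. by rewrite cartan_bE eqxx (eq_sym i) ordSS_neq sub0r. Qed.

Lemma cartan_b_prev i : cartan_b (ordS i) i = psign m (ordS i).
Proof. by rewrite cartan_bE eqxx (eq_sym i) ordSS_neq subr0. Qed.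

Lemma cartan_far i j : i != j -> j != ordS i -> i != ordS j ->
  cartan_a i j = 0 /\ cartan_b i j = 0.
Proof.
by rewrite cartan_aE cartan_bE => /negbTE -> /negbTE -> /negbTE ->;
  rewrite !subr0.
Qed.

Lemma sqr_cartan_adj i j : i != j -> cartan_a i j != 0 ->
  cartan_a i j ^+ 2 = 1.
Proof.
move=> ne a0; rewrite expr2.
have [->|nj] := eqVneq j (ordS i); first by rewrite cartan_a_next mulrNN
  psign_sqr.
have [->|ni] := eqVneq i (ordS j).
  by rewrite cartan_aC cartan_a_next mulrNN psign_sqr.
by case/eqP: a0; case: (cartan_far ne nj ni).
Qed.

Lemma absz_cartan i j : i != j ->
  cartan_a i j = 0 \/ cartan_a i j != 0 /\ absz (cartan_a i j) = 1%N.
Proof.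
move=> ne; case: (eqVneq (cartan_a i j) 0) => [->|a0]; [by left|right].
by split=> //; have /eqP := sqr_cartan_adj ne a0; rewrite sqrf_eq1 =>
  /orP[]/eqP ->.
Qed.

Lemma odd_cartan i : odd_node i = (cartan_a i i == 0).
Proof.
rewrite cartan_a_self psignS /odd_node /psign.
have lti := ltn_ord i.
have [->|i0] := eqVneq (i : nat) 0%N; first by case: (m) hm.
have [->|im] := eqVneq (i : nat) m.
  by rewrite leqnn (ltnW hm) ltnn andbF.
have i_gt0 : (0 < i)%N by rewrite lt0n.
by rewrite i_gt0 [(i <= m)%N]leq_eqVlt (negbTE im); case: (ltnP i m).
Qed.

(** Since m and n are at least 2, the two odd nodes are never adjacent. *)
Lemma odd_adj i j : i != j -> cartan_a i j != 0 ->
  odd_node i && odd_node j = false.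
Proof.
move=> ne; apply: contraNF; rewrite /odd_node => /andP[/orP oi /orP oj].
have {}oi : (i = 0%N :> nat) \/ (i = m :> nat) by case: oi => /eqP;
  [left|right].
have {}oj : (j = 0%N :> nat) \/ (j = m :> nat) by case: oj => /eqP;
  [left|right].
have [ltiN ltjN] := (ltn_ord i, ltn_ord j).
have ne' : i <> j :> nat by move/val_inj => e; rewrite e eqxx in ne.
have nj : j != ordS i by rewrite eq_ordS; case: ifP => [/eqP|] ?; lia.
have ni : i != ordS j by rewrite eq_ordS; case: ifP => [/eqP|] ?; lia.
by have [-> _] := cartan_far ne nj ni.
Qed.

Lemma cartan_next_neq0 i : cartan_a i (ordS i) != 0.
Proof. by rewrite cartan_a_next oppr_eq0 /psign signr_eq0. Qed.

(** Both neighbours of i are candidates; the one that is not j is not adjacent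
    to j, as the cycle has at least four nodes. *)
Lemma far_neighbour i j : i != j -> cartan_a i j != 0 ->
  exists k, [/\ k != i, k != j, cartan_a k i != 0 & cartan_a k j = 0].
Proof.
move=> ne a0; have [ej|nj] := eqVneq j (ordS i).
  exists (ord_pred i).
  have np : ordS (ord_pred i) != ord_pred i by rewrite ordS_neq.
  have := cartan_next_neq0 (ord_pred i); rewrite ord_predK in np * => ai.
  have nk : ord_pred i != j by rewrite ej eq_sym eq_ord_pred eq_sym ordSS_neq.
  split=> //; first by rewrite eq_sym.
  have [] // := @cartan_far (ord_pred i) j nk.
    by rewrite ord_predK eq_sym.
  by rewrite ej eq_sym eq_ord_pred eq_sym ordSSS_neq.
have [ei|ni] := eqVneq i (ordS j); last by have [E _] := cartan_far ne nj ni;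
  rewrite E in a0.
exists (ordS i); rewrite ordS_neq cartan_aC cartan_next_neq0; split=> //.
  by rewrite ei ordSS_neq.
have [] // := @cartan_far (ordS i) j.
- by rewrite ei ordSS_neq.
- by rewrite ei eq_sym ordSSS_neq.
- by rewrite -ei ordS_neq.
Qed.

Lemma ordS_invariant_const (T : Type) (f : 'I_(m + n) -> T) :
  (forall i, f (ordS i) = f i) -> forall i j, f i = f j.
Proof.
move=> fS; have N0 : (0 < m + n)%N by lia.
suff f0 i : f i = f (Ordinal N0) by move=> i j; rewrite !f0.
case: i => i; elim: i => [|i IH] lti; first by congr f; apply: val_inj.
rewrite -(IH (ltnW lti)) -[RHS]fS; congr f; apply/eqP; rewrite eq_ordS /=.
by case: ifP => //; lia.
Qed.

Lemma sum_psign : \sum_i psign m (i : 'I_(m + n)) = m%:Z - n%:Z.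
Proof.
rewrite -(big_mkord xpredT (psign m)) (@big_cat_nat _ _ _ 1) //=; last by lia.
rewrite big_nat1 (@big_cat_nat _ _ _ m.+1) //=; last by lia.
rewrite (eq_big_nat _ _ (F2 := fun=> 1)); last first.
  by move=> i hi; rewrite /psign; have -> : (1 <= i <= m)%N by lia.
rewrite [X in _ + (_ + X)](eq_big_nat _ _ (F2 := fun=> -1)); last first.
  move=> i hi; rewrite /psign.
  by have -> : (1 <= i <= m)%N = false by lia.
rewrite !sumr_const_nat /psign /=; lia.
Qed.

Section Image.
Context (K : fieldType) (char0 : [pchar K] =i pred0).
Local Notation s i := ((psign m i)%:~R : K).

Lemma sum_delta (f : 'I_(m + n) -> K) i : \sum_j f j *+ (j == i) = f i.
Proof. by rewrite (bigD1 i) //= eqxx big1 ?addr0 // => j /negbTE ->. Qed.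

Lemma sum_ordS (f : 'I_(m + n) -> K) : \sum_j f (ordS j) = \sum_j f j.
Proof. by rewrite [RHS](reindex_inj (@ordS_inj _)). Qed.

Lemma sum_ord_pred (f : 'I_(m + n) -> K) : \sum_j f (ord_pred j) = \sum_j f j.
Proof. by rewrite [RHS](reindex_inj (@ord_pred_inj _)). Qed.

Lemma sum_cartan_a (f : 'I_(m + n) -> K) j :
  \sum_l f l * (cartan_a l j)%:~R =
  s j * (f j - f (ord_pred j)) - s (ordS j) * (f (ordS j) - f j).
Proof.
transitivity (\sum_l ((f l * (s j + s (ordS j))) *+ (l == j)
    - (f l * s (ordS j)) *+ (l == ordS j) - (f l * s j) *+ (l == ord_pred j))).
  apply: eq_bigr => l _; rewrite cartan_aC cartan_aE !rmorphB !rmorphMn !rmorphD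
    /=.
  rewrite [j == l]eq_sym.
  rewrite eq_ord_pred.
  case: (eqVneq l (ordS j)) => [->|_];
    case: (j == _); case: (l == j); case: (_ == j) => //=;
      rewrite ?mulr1n ?mulr0n; ring.
by rewrite !sumrB !sum_delta; ring.
Qed.

Lemma sum_cartan_ab (f : 'I_(m + n) -> K) j :
  \sum_l f l * (cartan_a l j)%:~R * (cartan_b l j)%:~R
  = f (ord_pred j) - f (ordS j).
Proof.
transitivity (\sum_l (f l *+ (l == ord_pred j) - f l *+ (l == ordS j))).
  apply: eq_bigr => l _.
  rewrite eq_ord_pred.
  case: (eqVneq j (ordS l)) => [->|nj].
    rewrite cartan_a_next cartan_b_next (eq_sym l) ordSS_neq mulr1n subr0.
    by rewrite -mulrA -intrM mulrNN psign_sqr mulr1.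
  case: (eqVneq l (ordS j)) => [->|nl].
    rewrite cartan_aC cartan_a_next cartan_b_prev mulr1n sub0r.
    by rewrite -mulrA -intrM mulNr psign_sqr mulrN1.
  rewrite subr0; have [->|ne] := eqVneq l j; first by rewrite cartan_b_self
    mulr0.
  by have [_ ->] := cartan_far ne nj nl; rewrite mulr0.
by rewrite sumrB !sum_delta.
Qed.

(** The entries of a and b agree at (l, l + 1) and are opposite at (l + 1, l),
    so the inner sum is a difference of two translates of f. *)
Lemma sum_cartan_ab0 (f : 'I_(m + n) -> K) :
  \sum_j \sum_l f l * (cartan_a l j)%:~R * (cartan_b l j)%:~R = 0.
Proof.
rewrite (eq_bigr _ (fun j _ => sum_cartan_ab f j)) sumrB.
by rewrite sum_ordS sum_ord_pred subrr.
Qed.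

Lemma natr_eq0_char0 (k : nat) : (k%:R == 0 :> K) = (k == 0)%N.
Proof. by move/pcharf0P: char0; apply. Qed.

Lemma natr_inj_char0 (k l : nat) : k%:R = l%:R :> K -> k = l.
Proof.
wlog le : k l / (k <= l)%N => [H|].
  by case: (leqP k l) => [|/ltnW] le E; [|symmetry]; apply: H.
move=> /eqP; rewrite -(subnKC le) natrD -subr_eq0 opprD addrA subrr sub0r.
by rewrite oppr_eq0 natr_eq0_char0 => /eqP ->; rewrite addn0.
Qed.

(** The quadratic form of the Cartan matrix is a weighted Dirichlet form on the
    cycle with weights psign.  A vector w in its kernel has constant flux
    psign_l (w_l - w_{l-1}); summing the increments around the cycle shows that
    this flux times m - n vanishes, so w is constant.  The matrix being
    symmetric, its image is the orthogonal of the constant vectors. *)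
Lemma cartan_image (v : 'I_(m + n) -> K) : m <> n -> \sum_j v j = 0 ->
  exists c, forall j, \sum_l c l * (cartan_a l j)%:~R = v j.
Proof.
move=> neq sv; pose M : 'M[K]_(m + n) := \matrix_(l, j) (cartan_a l j)%:~R.
suff /submxP[c cM] : (\row_j v j <= M)%MS.
  exists (fun l => c 0 l) => j; move/matrixP/(_ 0 j): cM; rewrite !mxE => ->.
  by apply: eq_bigr => l _; rewrite !mxE.
rewrite submxE; apply/eqP/matrixP => i k; rewrite [LHS]mxE [RHS]mxE.
pose w (j : 'I_(m + n)) : K := cokermx M j k.
have Mw (l : 'I_(m + n)) : s l * (w l - w (ord_pred l)) = s (ordS l) * (w (ordS
  l) - w l).
  apply/eqP; rewrite -subr_eq0 -sum_cartan_a; apply/eqP.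
  have := mulmx_coker M => /matrixP/(_ l k); rewrite [LHS]mxE [RHS]mxE => Mw0.
  by rewrite -[RHS]Mw0; apply: eq_bigr => j _;
    rewrite [M l j]mxE cartan_aC mulrC.
pose d (l : 'I_(m + n)) := s l * (w l - w (ord_pred l)).
have dS l : d (ordS l) = d l by rewrite /d ordSK Mw.
have wd l : w l - w (ord_pred l) = s l * d l.
  by rewrite /d mulrA -intrM psign_sqr mul1r.
have N0 : (0 < m + n)%N by lia.
pose i0 := Ordinal N0.
have d0 l : d l = 0.
  apply/eqP; rewrite (ordS_invariant_const dS l i0).
  have : \sum_l (w l - w (ord_pred l)) = 0.
    by rewrite sumrB sum_ord_pred subrr.
  under eq_bigr do rewrite wd (ordS_invariant_const dS _ i0).
  rewrite -mulr_suml -rmorph_sum /= sum_psign => /eqP; rewrite mulf_eq0.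
  by case/orP => //; rewrite rmorphB subr_eq0 => /eqP /natr_inj_char0.
have wS l : w (ordS l) = w l.
  by apply/eqP; rewrite -subr_eq0 -[X in _ - w X]ordSK wd d0 mulr0.
rewrite (eq_bigr (fun j => v j * w i0)); first by rewrite -mulr_suml sv mul0r.
by move=> j _; rewrite [X in X * _]mxE -(ordS_invariant_const wS j i0).
Qed.

End Image.

End Cycle.

(** * Commutators, super brackets and Cartan currents *)

Definition ad (K : pzRingType) (A : algType K) (t u : A) : A := t * u - u * t.

Arguments ad : simpl never.

Section Commutators.
Context (K : comNzRingType) (A : algType K).
Implicit Types t u v : A.

Lemma ad_is_linear t : linear (ad t).
Proof. by move=> k u v; rewrite /ad; nc_ring K A. Qed.
HB.instance Definition _ t := GRing.isLinear.Build K A A *:%R (ad t)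
  (ad_is_linear t).

Lemma ad0r t : ad t 0 = 0. Proof. exact: linear0. Qed.
Lemma adDr t u v : ad t (u + v) = ad t u + ad t v. Proof. exact: linearD. Qed.
Lemma adBr t u v : ad t (u - v) = ad t u - ad t v. Proof. exact: linearB. Qed.
Lemma adZr t k u : ad t (k *: u) = k *: ad t u. Proof. exact: linearZ. Qed.

Lemma adZl k t u : ad (k *: t) u = k *: ad t u.
Proof. by rewrite /ad; nc_ring K A. Qed.

Lemma adDl t t' u : ad (t + t') u = ad t u + ad t' u.
Proof. by rewrite /ad; nc_ring K A. Qed.

Lemma adBl t t' u : ad (t - t') u = ad t u - ad t' u.
Proof. by rewrite /ad; nc_ring K A. Qed.

Lemma ad_suml (I : Type) (r : seq I) (P : pred I) (f : I -> A) u :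
  ad (\sum_(i <- r | P i) f i) u = \sum_(i <- r | P i) ad (f i) u.
Proof. by rewrite /ad mulr_suml mulr_sumr -sumrB. Qed.

Lemma adM t u v : ad t (u * v) = ad t u * v + u * ad t v.
Proof. by rewrite /ad; nc_ring K A. Qed.

Lemma adMl t t' u : ad (t * t') u = t * ad t' u + ad t u * t'.
Proof. by rewrite /ad; nc_ring K A. Qed.

Lemma ad_anticomm t (u v : A) : ad t (u * v + v * u) =
  (ad t u * v + v * ad t u) + (u * ad t v + ad t v * u).
Proof. by rewrite /ad; nc_ring K A. Qed.

Lemma adC t u : ad t u = - ad u t.
Proof. by rewrite /ad opprB. Qed.

Lemma ad_ad t t' u : ad t t' = 0 -> ad t (ad t' u) = ad t' (ad t u).
Proof.
move=> tt'; apply/eqP; rewrite -subr_eq0; apply/eqP.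
transitivity (ad (ad t t') u); first by rewrite /ad; nc_ring K A.
by rewrite tt' /ad mul0r mulr0 subrr.
Qed.

End Commutators.

Section SuperBracket.
Context (K : comNzRingType) (A : superAlgType K).
Implicit Types t u v w : A.

Definition even u := hcomp false u = u.

Lemma sbracket_linl k u v w :
  sbracket (k *: u + v) w = k *: sbracket u w + sbracket v w.
Proof.
rewrite /sbracket scaler_sumr -big_split; apply: eq_bigr => p _ /=.
rewrite scaler_sumr -big_split; apply: eq_bigr => q _ /=.
by rewrite hcomp_linear; case: p; case: q; rewrite /= ?expr0 ?expr1;
  nc_ring K A.
Qed.

Lemma sbracket_linr k u v w :
  sbracket w (k *: u + v) = k *: sbracket w u + sbracket w v.
Proof.
rewrite /sbracket scaler_sumr -big_split; apply: eq_bigr => p _ /=.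
rewrite scaler_sumr -big_split; apply: eq_bigr => q _ /=.
by rewrite hcomp_linear; case: p; case: q; rewrite /= ?expr0 ?expr1;
  nc_ring K A.
Qed.

HB.instance Definition _ u :=
  GRing.isLinear.Build K A A *:%R (sbracket u) (fun k v w =>
    sbracket_linr k v w u).

Lemma sbracket0r w : sbracket w 0 = 0 :> A. Proof. exact: linear0. Qed.
Lemma sbracketDr w u v : sbracket w (u + v) = sbracket w u + sbracket w v.
Proof. exact: linearD. Qed.
Lemma sbracketZr w k u : sbracket w (k *: u) = k *: sbracket w u.
Proof. exact: linearZ. Qed.

Lemma sbracketDl u v w : sbracket (u + v) w = sbracket u w + sbracket v w.
Proof. by rewrite -[u]scale1r sbracket_linl !scale1r. Qed.

Lemma sbracket0l w : sbracket 0 w = 0 :> A.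
Proof. by apply: (addIr (sbracket 0 w)); rewrite -sbracketDl !add0r. Qed.

Lemma sbracketZl k u w : sbracket (k *: u) w = k *: sbracket u w.
Proof. by rewrite -[k *: u]addr0 sbracket_linl sbracket0l addr0. Qed.

Lemma sbracketBl u v w : sbracket (u - v) w = sbracket u w - sbracket v w.
Proof. by rewrite sbracketDl -[- v]scaleN1r sbracketZl scaleN1r. Qed.

Lemma sbracket_sgE p q u v : hcomp p u = u -> hcomp q v = v ->
  sbracket u v = u * v - ((-1) ^+ (p && q) : K) *: (v * u).
Proof.
move=> pu qv; rewrite (sbracketE pu qv).
by case: (p && q); rewrite ?expr0 ?expr1 ?scaleN1r ?scale1r ?mulN1r ?mul1r.
Qed.

Lemma sbracket_even t u : even t -> sbracket t u = ad t u.
Proof.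
move=> et; rewrite -[u in LHS]hcomp_sum linearD /=.
have homog q : sbracket t (hcomp q u) = ad t (hcomp q u).
  rewrite (@sbracket_sgE false q) //; first by rewrite expr0 scale1r.
  by rewrite hcomp_proj eqxx.
by rewrite !homog -linearD hcomp_sum.
Qed.

Lemma hcomp_ad t p u : even t -> hcomp p (ad t u) = ad t (hcomp p u).
Proof.
move=> et; rewrite -{1}[u]hcomp_sum linearD hcompD /=.
have homog q : hcomp p (ad t (hcomp q u)) = if p == q then ad t (hcomp q u) else
  0.
  apply: hcomp_homog.
  have hq : hcomp q (hcomp q u) = hcomp q u by rewrite hcomp_proj eqxx.
  rewrite /ad hcompD hcompN -[X in hcomp X (t * _)]addFb.
  by rewrite -[X in _ - hcomp X _]addbF !hcomp_mul.
by rewrite !homog; case: p {homog}; rewrite ?add0r ?addr0.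
Qed.

Lemma ad_sbracket t u v : even t ->
  ad t (sbracket u v) = sbracket (ad t u) v + sbracket u (ad t v).
Proof.
move=> et; rewrite /sbracket linear_sum -big_split; apply: eq_bigr => p _ /=.
rewrite linear_sum -big_split; apply: eq_bigr => q _ /=.
rewrite !hcomp_ad //; case: p; case: q; rewrite /= ?expr0 ?expr1 /ad;
  nc_ring K A.
Qed.

Lemma ad_acomm t u v :
  ad t (anticomm u v) = anticomm (ad t u) v + anticomm u (ad t v).
Proof. exact: ad_anticomm. Qed.

Lemma hcomp_sbracket p q u v : hcomp p u = u -> hcomp q v = v ->
  hcomp (p (+) q) (sbracket u v) = sbracket u v.
Proof.
move=> hu hv; rewrite (sbracket_sgE hu hv) hcompD hcompN hcompZ hcomp_mul //.
by rewrite addbC hcomp_mul.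
Qed.

Lemma evenD u v : even u -> even v -> even (u + v).
Proof. by rewrite /even hcompD => -> ->. Qed.

Lemma evenN u : even u -> even (- u).
Proof. by rewrite /even hcompN => ->. Qed.

Lemma evenZ k u : even u -> even (k *: u).
Proof. by rewrite /even hcompZ => ->. Qed.

Lemma evenM u v : even u -> even v -> even (u * v).
Proof. by move=> eu ev; have := hcomp_mul false false u v eu ev. Qed.

End SuperBracket.

(** The common form of the action of the h_{i,r} on the currents X_s of
    x^+_{j,s} and Y_t of x^-_{j,t}, in bases in which the anticommutator of the
    defining relation has become a product with h_r on one side.  The relations
      are assumed for r < M only, as needed in an
    induction on the degree. *)
Section CartanCurrent.
Context (K : comNzRingType) (A : algType K) (e c sgn : K).
Context (h X Y : nat -> A) (M : nat).
Hypothesis hX0 : forall s, ad (h 0) (X s) = e *: X s.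
Hypothesis hY0 : forall s, ad (h 0) (Y s) = - e *: Y s.
Hypothesis hXS : forall r s, (r < M)%N ->
  ad (h r.+1) (X s) = ad (h r) (X s.+1) + (e * c) *: (X s * h r).
Hypothesis hYS : forall r s, (r < M)%N ->
  ad (h r.+1) (Y s) = ad (h r) (Y s.+1) - (e * c) *: (h r * Y s).

Lemma ad_current_X k s : (k <= M)%N -> ad (h k) (X s) =
  e *: X (s + k)%N + (e * c) *: \sum_(p < k) X (s + p)%N * h (k - p.+1)%N.
Proof.
elim: k s => [|k IH] s lekM; first by rewrite hX0 big_ord0 scaler0 addr0 addn0.
rewrite hXS // IH 1?ltnW // big_ord_recl /= addn0 subn1 addnS addSn -addrA.
congr (_ + _); rewrite -scalerDr addrC; congr (_ *: (_ + _)).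
by apply: eq_bigr => p _; rewrite /bump /= addnS subSS addSn.
Qed.

Lemma ad_current_Y k s : (k <= M)%N -> ad (h k) (Y s) =
  - (e *: Y (s + k)%N + (e * c) *: \sum_(p < k) h (k - p.+1)%N * Y (s + p)%N).
Proof.
elim: k s => [|k IH] s lekM.
  by rewrite hY0 big_ord0 scaler0 addr0 addn0 scaleNr.
rewrite hYS // IH 1?ltnW // big_ord_recl /= addn0 subn1 addnS addSn -opprD
  -addrA.
congr (- (_ + _)); rewrite -scalerDr addrC; congr (_ *: (_ + _)).
by apply: eq_bigr => p _; rewrite /bump /= addnS subSS addSn.
Qed.

(** Both sides sum over the pairs with p + u < k - 1. *)
Lemma triangle_sumC (V : zmodType) (f : nat -> nat -> V) k :
  \sum_(p < k) \sum_(u < k - p.+1) f p u = \sum_(p < k) \sum_(u < k - p.+1) f u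
    p.
Proof.
have widen (g : nat -> V) (p : 'I_k) : \sum_(u < k - p.+1) g u = \sum_(u < k |
  (p + u < k.-1)%N) g u.
  rewrite (big_ord_widen k g (leq_subr _ _)); apply: eq_bigl => u.
  by have := ltn_ord p; lia.
under eq_bigr do rewrite (widen (f _)).
under [RHS]eq_bigr do rewrite (widen (fun u => f u _)).
rewrite (exchange_big_dep xpredT) //=; apply: eq_bigr => p _.
by apply: eq_bigl => u; rewrite addnC.
Qed.

Definition current_pair s t := X s * Y t - sgn *: (Y t * X s).

(** By the Leibniz rule the left side involves the actions of h_k on X_s and on
    Y_t.  The terms in which a pair of currents is multiplied by some h cancel
    by the assumption.  The others are sums over p + q = k - 1, which vanish by
    the exchange of p and q in the terms linear in c, and over
    p + q + u = k - 2, which vanish by the exchange of p and u in the terms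
    quadratic in c; only the extreme terms survive. *)
Lemma ad_current_pair k s t : (k <= M)%N ->
  (forall p, (p < k)%N -> current_pair (s + p) t * h (k - p.+1)%N
                          = h (k - p.+1)%N * current_pair s (t + p)) ->
  ad (h k) (current_pair s t)
  = e *: (current_pair (s + k) t - current_pair s (t + k)).
Proof.
move=> lekM comm.
have expand (F F' : 'I_k -> A) (G : 'I_k -> A) :
    \sum_p (F p + F' p - G p) = \sum_p F p + \sum_p F' p - \sum_p G p.
  by rewrite sumrB big_split.
transitivity (e *: (current_pair (s + k) t - current_pair s (t + k)) + (e * c)
  *:
   (\sum_(p < k) (X (s + p)%N * ad (h (k - p.+1)%N) (Y t)
                 + ad (h (k - p.+1)%N) (X s) * Y (t + p)%N))).
  transitivity (ad (h k) (X s) * Y t + X s * ad (h k) (Y t)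
    - sgn *: (ad (h k) (Y t) * X s + Y t * ad (h k) (X s))).
    by rewrite /current_pair linearB linearZ /= !adM.
  rewrite !ad_current_X // !ad_current_Y //.
  have -> : \sum_(p < k) (X (s + p)%N * ad (h (k - p.+1)%N) (Y t)
                 + ad (h (k - p.+1)%N) (X s) * Y (t + p)%N) =
     (\sum_(p < k) X (s + p)%N * h (k - p.+1)%N) * Y t
     - sgn *: (Y t * (\sum_(p < k) X (s + p)%N * h (k - p.+1)%N))
     - X s * (\sum_(p < k) h (k - p.+1)%N * Y (t + p)%N)
     + sgn *: ((\sum_(p < k) h (k - p.+1)%N * Y (t + p)%N) * X s).
    rewrite !mulr_suml !mulr_sumr !scaler_sumr -!sumrB -big_split /=.
    apply: eq_bigr => p _; have := comm p (ltn_ord p).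
    rewrite /ad /current_pair; set g := h _ => cg.
    apply/eqP; rewrite -subr_eq0; apply/eqP.
    transitivity (g * (X s * Y (t + p)%N - sgn *: (Y (t + p)%N * X s))
      - (X (s + p)%N * Y t - sgn *: (Y t * X (s + p)%N)) * g);
          last by rewrite cg subrr.
    by nc_ring K A.
  by rewrite /current_pair; nc_ring K A.
suff -> : \sum_(p < k) (X (s + p)%N * ad (h (k - p.+1)%N) (Y t)
                 + ad (h (k - p.+1)%N) (X s) * Y (t + p)%N) = 0.
  by rewrite scaler0 addr0.
have lek p : (k - p.+1 <= M)%N by rewrite (leq_trans (leq_subr _ _)).
under eq_bigr do rewrite ad_current_X // ad_current_Y //.
transitivity (e *: (\sum_(p < k) X (s + (k - p.+1))%N * Y (t + p)%N
                  - \sum_(p < k) X (s + p)%N * Y (t + (k - p.+1))%N)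
  + (e * c) *: (
     \sum_(p < k) \sum_(u < k - p.+1) X (s + u)%N * h (k - p.+1 - u.+1)%N * Y (t
       + p)%N
   - \sum_(p < k) \sum_(u < k - p.+1) X (s + p)%N * (h (k - p.+1 - u.+1)%N * Y
       (t + u)%N))).
  rewrite -!sumrB !scaler_sumr -big_split /=; apply: eq_bigr => p _.
  rewrite -mulr_suml -mulr_sumr; set x1 := \sum_(_ < _) X _ * _; set y1 :=
    \sum_(_ < _) h _ * _.
  by nc_ring K A.
have -> : \sum_(p < k) X (s + (k - p.+1))%N * Y (t + p)%N
          = \sum_(p < k) X (s + p)%N * Y (t + (k - p.+1))%N.
  rewrite [LHS](reindex_inj rev_ord_inj) /=; apply: eq_bigr => p _.
  by congr (X _ * Y _); have := ltn_ord p; lia.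
rewrite subrr scaler0 add0r.
rewrite (triangle_sumC (fun p u => X (s + u)%N * h (k - p.+1 - u.+1)%N * Y (t +
  p)%N)).
rewrite -sumrB big1 ?scaler0 // => p _.
apply/eqP; rewrite subr_eq0; apply/eqP; apply: eq_bigr => u _.
by rewrite mulrA; congr (_ * h _ * _); lia.
Qed.

End CartanCurrent.

(** * Extending a minimal family *)

(** The map z |-> z * y - sgn * (y * z) commutes with the multiplications by
    elements that commute with y.  With y a generator opposite to x_{i,r}, it
    carries the relation between x_{i,r} and the currents of another node to
    the same relation with x_{i,r} replaced by its bracket with y. *)
Lemma current_transfer (K : comNzRingType) (A : algType K) (sgn al be : K)
    (u u' v v' y : A) :
  v * y = y * v -> v' * y = y * v' ->
  ad u' v - ad u v' = al *: (u * v + v * u) - be *: ad u v ->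
  let p z := z * y - sgn *: (y * z) in
  ad (p u') v - ad (p u) v' = al *: (p u * v + v * p u) - be *: ad (p u) v.
Proof.
move=> vy v'y E p.
have pN z : p (- z) = - p z by rewrite /p; nc_ring K A.
have pD z w : p (z + w) = p z + p w by rewrite /p; nc_ring K A.
have pZ k z : p (k *: z) = k *: p z by rewrite /p; nc_ring K A.
have pr w z : w * y = y * w -> p (z * w) = p z * w.
  by move=> wy; rewrite /p -mulrA wy mulrBl -scalerAl !mulrA.
have pl w z : w * y = y * w -> p (w * z) = w * p z.
  by move=> wy; rewrite /p mulrA -wy mulrBr -scalerAr !mulrA.
have := congr1 p E; rewrite /ad !(pD, pN, pZ).
by rewrite !(pr v) // !(pr v') // !(pl v) // !(pl v').
Qed.

Lemma scomm_product (K : comNzRingType) (A : algType K) (z : K) (u v y : A) :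
  z * z = 1 -> u * v = z *: (v * u) -> v * y = z *: (y * v) ->
  ad (u * y) v = 0 /\ ad (y * u) v = 0.
Proof.
move=> zz uv vy; have yv : y * v = z *: (v * y) by rewrite vy scalerA zz
  scale1r.
have e1 : u * y * v = v * (u * y).
  by rewrite -mulrA yv -scalerAr (mulrA u) uv -scalerAl scalerA zz scale1r
    mulrA.
have e2 : y * u * v = v * (y * u).
  by rewrite -mulrA uv -scalerAr (mulrA y) yv -scalerAl scalerA zz scale1r
    mulrA.
by rewrite /ad e1 e2 !subrr.
Qed.

(** For commuting h_r the element acting here is the coefficient of z^(-3)
    in log (1 + c * \sum_r h_r z^(-r-1)), divided by c.  The series acts on a
    current by multiplication with a rational function of the shift, so the
    coefficients of its logarithm act by polynomials in the shift, without any
    contribution of the h_r. *)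
Lemma quadratic_shift (K : fieldType) (A : algType K) (e c : K)
    (h0 h1 h2 X0 X1 X2 : A) :
  (3%:R : K) != 0 -> e * e = 1 ->
  ad h0 X0 = e *: X0 -> ad h0 X1 = e *: X1 ->
  ad h1 X0 = e *: X1 + (e * c) *: (X0 * h0) ->
  ad h2 X0 = e *: X2 + (e * c) *: (X1 * h0 + X0 * h1) ->
  ad (h2 - c *: (h1 * h0) + (c ^+ 2 / 3) *: (h0 * (h0 * h0))) X0
  = e *: X2 - c *: X1 + (e * c ^+ 2 / 3) *: X0.
Proof.
move=> nz3 ee d0 d0' d1 d2.
have s0 : h0 * X0 = X0 * h0 + e *: X0 by rewrite -d0 /ad; nc_ring K A.
have s1 : h1 * X0 = X0 * h1 + (e *: X1 + (e * c) *: (X0 * h0)).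
  by rewrite -d1 /ad; nc_ring K A.
have e12 : e = 1 \/ e = -1.
  by move: ee => /eqP; rewrite -expr2 sqrf_eq1 => /orP[]/eqP ->; [left|right].
have h00 : h0 * h0 * X0 = X0 * h0 * h0 + (e + e) *: (X0 * h0) + X0.
  rewrite -mulrA s0 mulrDr mulrA s0 -scalerAr s0.
  by case: e12 => ->; nc_ring K A.
have e3 : h0 * (h0 * h0) * X0 = X0 * h0 * h0 * h0
    + (3%:R * e) *: (X0 * h0 * h0) + (3%:R : K) *: (X0 * h0) + e *: X0.
  rewrite -mulrA h00 !mulrDr !mulrA s0 -scalerAr mulrA s0.
  by case: e12 => ->; nc_ring K A.
have e2 : h1 * h0 * X0 = X0 * h1 * h0 + e *: (X1 * h0)
    + (e * c) *: (X0 * h0 * h0) + e *: (X0 * h1) + X1 + c *: (X0 * h0).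
  rewrite -mulrA s0 mulrDr mulrA s1 -scalerAr s1.
  by case: e12 => ->; nc_ring K A.
rewrite adDl adBl !adZl d2 /ad e2 e3.
by case: e12 => ->; nc_prep K A; field; rewrite ?nz3.
Qed.

(** Read F r s as the image of X^r Y^s under a linear map on polynomials that
    factors through symmetrization.  The last two hypotheses say that
    multiplication by X + Y and by X^2 + Y^2 preserves vanishing; these
    generate the symmetric polynomials because 2 is invertible. *)
Lemma symmetric_vanish (K : fieldType) (V : lmodType K) (F : nat -> nat -> V) :
  (2%:R : K) != 0 -> (forall r s, F r s = F s r) -> F 0%N 0%N = 0 ->
  (forall r s, F r s = 0 -> F r.+1 s + F r s.+1 = 0) ->
  (forall r s, F r s = 0 -> F r.+2 s + F r s.+2 = 0) ->
  forall r s, F r s = 0.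
Proof.
move=> nz2 FC F00 F1 F2.
have dbl u : u + u = 0 :> V -> u = 0.
  move=> u2; have : (2%:R : K) *: u = 0 by rewrite scaler_nat mulr2n.
  by move/eqP; rewrite scaler_eq0 (negbTE nz2) => /eqP.
suff H d r s : (r + s < d)%N -> F r s = 0 by move=> r s; apply: (H (r + s).+1).
elim: d r s => // d IH.
have F02 r s : (r + s.+2 < d.+1)%N -> F r s.+2 = 0.
  move=> lt; have := F2 r s (IH r s _); have := F1 r.+1 s (IH r.+1 s _).
  have := F1 r s.+1 (IH r s.+1 _) => E1 E2 E3.
  apply: dbl.
  have {}E1 : F r.+1 s.+1 = - F r s.+2 by apply/eqP; rewrite -addr_eq0 E1 //;
    lia.
  have {}E2 : F r.+2 s = - F r.+1 s.+1 by apply/eqP; rewrite -addr_eq0 E2 //;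
    lia.
  by rewrite -{1}[F r s.+2]opprK -E1 -E2 E3 //; lia.
case=> [|[|r]] [|[|s]] lt //; try exact: F02; try by rewrite FC; apply: F02;
  lia.
- by apply: dbl; rewrite {1}FC F1.
- by apply: dbl; rewrite {2}FC F1.
- have F01 : F 0%N 1%N = 0 by apply: IH; lia.
  by have := F1 _ _ F01; rewrite F02 ?addr0.
Qed.

Section Minimal.
Context (K : fieldType) (char0 : [pchar K] =i pred0) (m n : nat) (eps1 eps2 : K)
  (A : superAlgType K).
Hypotheses (hm : (2 <= m)%N) (hn : (2 <= n)%N) (hmn : m <> n).
Context (x : bool -> 'I_(m + n) -> 'I_2 -> A) (h : 'I_(m + n) -> 'I_2 -> A).
Hypothesis x_par : forall e i r, hcomp (odd_node i) (x e i r) = x e i r.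
Hypothesis h_even : forall i r, even (h i r).
Hypothesis rel : forall u v, minimal_rel eps1 eps2 x h u v -> u = v.
Implicit Types (i j : 'I_(m + n)) (e : bool) (t u v : A).

Local Notation a i j := ((cartan_a i j)%:~R : K).
Local Notation b i j := ((cartan_b i j)%:~R : K).
Local Notation sg e := ((-1) ^+ nat_of_bool e : K).
Local Notation epsD := ((eps1 + eps2) / 2).
Local Notation epsB := ((eps1 - eps2) / 2).

Lemma sg_sqr e : sg e * sg e = 1.
Proof. by rewrite -expr2 sqrr_sign. Qed.

(** The even elements of the double commutant of the h_{i,r}: a convenient
    commutative algebra containing all elements that will act as shifts. *)
Definition torus t :=
  even t /\ forall u, (forall i r, ad (h i r) u = 0) -> ad t u = 0.

Lemma torus_h i r : torus (h i r).
Proof. by split=> // u; apply. Qed.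

Lemma torusD t u : torus t -> torus u -> torus (t + u).
Proof.
move=> [et ct] [eu cu]; split=> [|v hv]; first exact: evenD.
by rewrite adDl ct // cu // addr0.
Qed.

Lemma torusZ c t : torus t -> torus (c *: t).
Proof.
move=> [et ct]; split=> [|v hv]; first exact: evenZ.
by rewrite adZl ct // scaler0.
Qed.

Lemma torusM t u : torus t -> torus u -> torus (t * u).
Proof.
move=> [et ct] [eu cu]; split=> [|v hv]; first exact: evenM.
by rewrite adC adM adC ct // [ad v u]adC cu // oppr0 mul0r mulr0 addr0 oppr0.
Qed.

Lemma torus0 : torus 0.
Proof. by split=> [|v _]; [exact: hcomp0 | rewrite /ad mul0r mulr0 subrr]. Qed.

Lemma ad_hh i j r s : ad (h i r) (h j s) = 0.
Proof. by rewrite -sbracket_even //; apply: rel; constructor. Qed.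

Lemma torus_comm t u : torus t -> torus u -> ad t u = 0.
Proof.
move=> [_ ct] [_ cu]; apply: ct => i r; rewrite adC cu ?oppr0 // => j s.
exact: ad_hh.
Qed.

Lemma torus_htilde i : torus (htilde1 eps1 eps2 h i).
Proof.
rewrite /htilde1 -scaleNr; apply/torusD/torusZ; first exact: torus_h.
by rewrite expr2; apply: torusM; apply: torus_h.
Qed.

Lemma ad_h0 i e j r : ad (h i 0) (x e j r) = (sg e * a i j) *: x e j r.
Proof. by rewrite -sbracket_even //; apply: rel; constructor. Qed.

Lemma ad_htilde i e j : ad (htilde1 eps1 eps2 h i) (x e j 0)
  = (sg e * a i j) *: (x e j 1 - (b i j * epsB) *: x e j 0).
Proof.
have [et _] := torus_htilde i.
by rewrite -sbracket_even //; apply: rel; constructor.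
Qed.

(** For given p and q such an element acts at the node j as p_j times the shift
    of the degree plus q_j; the sign accounts for x^- having opposite
    weight. *)
Definition shifts t (p q : 'I_(m + n) -> K) := torus t /\
  forall e j, ad t (x e j 0) = sg e *: (p j *: x e j 1 + q j *: x e j 0).

Lemma shiftsD t t' p p' q q' : shifts t p q -> shifts t' p' q' ->
  shifts (t + t') (fun j => p j + p' j) (fun j => q j + q' j).
Proof.
move=> [tt at_] [tt' at']; split=> [|e j]; first exact: torusD.
by rewrite adDl at_ at'; nc_ring K A.
Qed.

Lemma shifts_eq t p q p' q' : p =1 p' -> q =1 q' -> shifts t p q ->
  shifts t p' q'.
Proof. by move=> ep eq [tt at_]; split=> // e j; rewrite at_ ep eq. Qed.

Lemma shifts_sum (f : 'I_(m + n) -> A) c p q :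
  (forall l, shifts (f l) (p l) (q l)) ->
  shifts (\sum_l c l *: f l) (fun j => \sum_l c l * p l j)
    (fun j => \sum_l c l * q l j).
Proof.
move=> sf; split=> [|e j].
  by apply: big_ind => [||l _]; [exact: torus0|exact: torusD|apply: torusZ;
    case: (sf l)].
rewrite ad_suml !scaler_suml -big_split scaler_sumr; apply: eq_bigr => l _ /=.
by have [_ afl] := sf l; rewrite adZl afl; nc_ring K A.
Qed.

Lemma shifts_h0 i : shifts (h i 0) (fun=> 0) (fun j => a i j).
Proof. by split=> [|e j]; [exact: torus_h|rewrite ad_h0; nc_ring K A]. Qed.

Lemma shifts_htilde i : shifts (htilde1 eps1 eps2 h i)
  (fun j => a i j) (fun j => - (a i j * b i j * epsB)).
Proof. by split=> [|e j]; [exact: torus_htilde|rewrite ad_htilde;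
  nc_ring K A]. Qed.

(** First the h~_{i,1} are combined to achieve p; this produces some q1, whose
    entries sum to zero as well, and the h_{i,0} correct q1 to q. *)
Lemma shifts_exists p q : \sum_j p j = 0 -> \sum_j q j = 0 ->
  exists t, shifts t p q.
Proof.
move=> sp sq; have [c cp] := cartan_image hm hn char0 hmn sp.
have := shifts_sum c shifts_htilde; set t1 := \sum_l _ => st1.
pose q1 j := \sum_l c l * - (a l j * b l j * epsB).
have sq1 : \sum_j (q j - q1 j) = 0.
  rewrite sumrB sq sub0r; apply/eqP; rewrite oppr_eq0; apply/eqP.
  transitivity (- epsB * \sum_j \sum_l c l * a l j * b l j).
    rewrite mulr_sumr; apply: eq_bigr => j _; rewrite mulr_sumr.
    by apply: eq_bigr => l _; ring.
  by rewrite sum_cartan_ab0 ?mulr0.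
have [d dq] := cartan_image hm hn char0 hmn sq1.
have st2 := shifts_sum d shifts_h0.
eexists; apply: shifts_eq (shiftsD st1 st2) => j /=.
  by rewrite cp -mulr_suml mulr0 addr0.
by rewrite dq addrC subrK.
Qed.

Lemma avoid i j l : exists k, [/\ k != i, k != j & k != l].
Proof.
have : (0 < #|~: [set i; j; l]|)%N.
  have := cardsC [set i; j; l]; rewrite card_ord => eN.
  have : (#|[set i; j; l]| <= 3)%N.
    rewrite (leq_trans (leq_card_setU _ _)) // cards1 cards2; by case: (_ != _).
  by lia.
by case/card_gt0P => k; rewrite !inE !negb_or => /andP[/andP[]]; exists k.
Qed.

(** The values c and d at the node i are balanced at a fourth node k. *)
Lemma shifts_one c d i j l : i != j -> i != l -> exists t p q,
  [/\ shifts t p q, p i = c /\ q i = d, p j = 0 /\ q j = 0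
    & p l = 0 /\ q l = 0].
Proof.
move=> nij nil; have [k [nki nkj nkl]] := avoid i j l.
pose f (z : K) (j' : 'I_(m + n)) : K := z *+ (j' == i) - z *+ (j' == k).
have f0 z : \sum_j' f z j' = 0 by rewrite sumrB !sum_delta subrr.
have [t st] := shifts_exists (f0 c) (f0 d).
exists t, (f c), (f d); split=> //; rewrite /f ?eqxx.
- by rewrite eq_sym (negbTE nki) !subr0.
- by rewrite [j == i]eq_sym [j == k]eq_sym (negbTE nij) (negbTE nkj) subrr.
- by rewrite [l == i]eq_sym [l == k]eq_sym (negbTE nil) (negbTE nkl) subrr.
Qed.

Section Currents.
Context (T : 'I_(m + n) -> A).
Hypothesis T_shifts : forall j, shifts (T j)
  (fun k => (k == j)%:R - (k == ordS j)%:R) (fun=> 0).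

(** The signed action of T j is the shift of the degree at the node j. *)
Definition raise (c : K) e j u := sg e *: ad (T j) u + c *: u.

(** For c = 0 these will be the generators x_{j,s} of all degrees.  In general
    they are the images of x_{j,0} under the powers of shift + c.  Changing c
    shifts the spectral parameter, which normalizes the relations between the
    node j and another node i for a value of c that depends on i and j. *)
Definition xcur (c : K) e j s := iter s (raise c e j) (x e j 0).

Arguments xcur : simpl never.

Lemma raise_linear c e j : linear (raise c e j).
Proof. by move=> k u v; rewrite /raise /ad; nc_ring K A. Qed.

Lemma raiseD c e j u v : raise c e j (u + v) = raise c e j u + raise c e j v.
Proof. by rewrite -[u]scale1r raise_linear !scale1r. Qed.

Lemma raiseZ c e j (d : K) u : raise c e j (d *: u) = d *: raise c e j u.
Proof. by rewrite /raise /ad; nc_ring K A. Qed.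

Lemma ad_raise t c e j u : torus t ->
  ad t (raise c e j u) = raise c e j (ad t u).
Proof.
move=> tt; have [tT _] := T_shifts j.
by rewrite /raise linearD !linearZ /= ad_ad // torus_comm.
Qed.

Lemma xcur1 c e j : xcur c e j 1 = x e j 1 + c *: x e j 0.
Proof.
have [_ aT] := T_shifts j.
rewrite /xcur /= /raise aT eqxx [_ == ordS _]eq_sym ordS_neq // subr0 scale1r
  scale0r addr0.
by rewrite scalerA sg_sqr scale1r.
Qed.

Lemma xcur01 e j : xcur 0 e j 1 = x e j 1.
Proof. by rewrite xcur1 scale0r addr0. Qed.

Lemma shifts_xcur t p q c e j s : shifts t p q -> ad t (xcur c e j s)
  = sg e *: (p j *: xcur c e j s.+1 + (q j - c * p j) *: xcur c e j s).
Proof.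
move=> [tt at_]; elim: s => [|s IH].
  by rewrite at_ xcur1 /xcur /=; nc_ring K A.
rewrite {1}/xcur iterS ad_raise // -[iter s _ _]/(xcur c e j s) IH raiseZ raiseD
  !raiseZ.
by [].
Qed.

Lemma xcur_par c e j s : hcomp (odd_node j) (xcur c e j s) = xcur c e j s.
Proof.
elim: s => [|s IH]; first exact: x_par.
have [[eT _] _] := T_shifts j.
by rewrite /xcur iterS -[iter s _ _]/(xcur c e j s) hcompD !hcompZ hcomp_ad //
  IH.
Qed.

Lemma xcur_shift c c' e j s :
  xcur c e j s.+1 = raise c' e j (xcur c e j s) + (c - c') *: xcur c e j s.
Proof. by rewrite {1}/xcur iterS -[iter s _ _]/(xcur c e j s) /raise;
  nc_ring K A. Qed.

(** The currents for different parameters span the same filtered space, with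
    the same leading terms.  A predicate closed under linear combinations
    replaces the span, which lets the induction pass through the shift. *)
Lemma xcur_change (P : A -> Prop) c c' e j s :
  P 0 -> (forall (d : K) u v, P u -> P v -> P (d *: u + v)) ->
  (forall l : nat, (l < s)%N -> P (xcur c e j l)) ->
    P (xcur c' e j s - xcur c e j s).
Proof.
elim: s P => [|s IH] P P0 Plin Pl; first by rewrite subrr.
have hs : P (xcur c' e j s - xcur c e j s) by apply: IH => // l ls;
  apply/Pl/ltnW.
have hr : P (raise c e j (xcur c' e j s - xcur c e j s)).
  apply: (IH (fun u => P (raise c e j u))) => [|d u v Pu Pv|l ls].
  - by rewrite -[0](scale0r 0) raiseZ scale0r.
  - by rewrite raise_linear; apply: Plin.
  - exact: (Pl l.+1 ls).
have -> : xcur c' e j s.+1 - xcur c e j s.+1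
  = (c' - c) *: (xcur c' e j s - xcur c e j s)
   + ((c' - c) *: xcur c e j s + raise c e j (xcur c' e j s - xcur c e j s)).
  rewrite (xcur_shift c' c) (xcur_shift c c) /raise /ad; nc_ring K A.
by apply: (Plin) => //; apply: (Plin) => //; apply: Pl.
Qed.

Lemma xcur_span (P : A -> Prop) c c' e j s :
  P 0 -> (forall (d : K) u v, P u -> P v -> P (d *: u + v)) ->
  (forall l : nat, (l <= s)%N -> P (xcur c e j l)) -> P (xcur c' e j s).
Proof.
move=> P0 Plin Pl; rewrite -[xcur c' e j s](subrK (xcur c e j s)) -[X in X +
  _]scale1r.
apply: (Plin); [apply: xcur_change; [exact: P0|exact: Plin|]|exact: Pl].
by move=> l ls; apply/Pl/ltnW.
Qed.

Definition isshift t := exists p q, shifts t p q.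

Lemma isshift_even t : isshift t -> even t.
Proof. by move=> [p [q [[]]]]. Qed.

(** The degree at i is raised while the nodes j and l are left alone; this is
    how a relation spreads from degree zero to all degrees. *)
Lemma raising c e i j l : i != j -> i != l -> exists t, [/\ isshift t,
  forall s, ad t (xcur c e i s) = xcur c e i s.+1,
  forall c' e' s, ad t (xcur c' e' j s) = 0 &
  forall c' e' s, ad t (xcur c' e' l s) = 0].
Proof.
move=> nij nil; have [t [p [q [st [pi qi] [pj qj] [pl ql]]]]] :=
  shifts_one (sg e) (c * sg e) nij nil.
exists t; split=> [|s|c' e' s|c' e' s]; first by exists p, q.
- rewrite (shifts_xcur c e i s st) pi qi subrr scale0r addr0.
  by rewrite scalerA sg_sqr scale1r.
- by rewrite (shifts_xcur c' e' j s st) pj qj mulr0 subr0 !scale0r addr0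
    scaler0.
- by rewrite (shifts_xcur c' e' l s st) pl ql mulr0 subr0 !scale0r addr0
    scaler0.
Qed.

Lemma weighing e i j l : i != j -> i != l -> exists t, [/\ isshift t,
  forall s, ad t (xcur 0 e i s) = xcur 0 e i s,
  forall c' e' s, ad t (xcur c' e' j s) = 0 &
  forall c' e' s, ad t (xcur c' e' l s) = 0].
Proof.
move=> nij nil; have [t [p [q [st [pi qi] [pj qj] [pl ql]]]]] :=
  shifts_one 0 (sg e) nij nil.
exists t; split=> [|s|c' e' s|c' e' s]; first by exists p, q.
- rewrite (shifts_xcur 0 e i s st) pi qi mulr0 subr0 scale0r add0r.
  by rewrite scalerA sg_sqr scale1r.
- by rewrite (shifts_xcur c' e' j s st) pj qj mulr0 subr0 !scale0r addr0
    scaler0.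
- by rewrite (shifts_xcur c' e' l s st) pl ql mulr0 subr0 !scale0r addr0
    scaler0.
Qed.

Lemma xy_off c c' i j r s : i != j ->
  sbracket (xcur c false i r) (xcur c' true j s) = 0.
Proof.
move=> nij; have nji : j != i by rewrite eq_sym.
have [t [/isshift_even et tr t0 _]] := raising c false nij nij.
have [t' [/isshift_even et' tr' t0' _]] := raising c' true nji nji.
elim: r => [|r IH]; last first.
  by have := congr1 (ad t) IH; rewrite ad0r ad_sbracket // tr t0 sbracket0r
    addr0.
elim: s => [|s IH]; last first.
  by have := congr1 (ad t') IH; rewrite ad0r ad_sbracket // tr' t0' sbracket0l
    add0r.
by have := rel (minimal_x0x0 eps1 eps2 x h i j); rewrite (negbTE nij) mulr0n.
Qed.

(** The parameter c is added to the coefficient of the bracket because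
    x_{j,s+1} is replaced by x_{j,s+1} + c x_{j,s} in the shifted currents. *)
Definition xex_defect c e i j r s :=
  sbracket (xcur 0 e i r.+1) (xcur c e j s)
  - sbracket (xcur 0 e i r) (xcur c e j s.+1)
  - ((sg e * a i j * epsD) *: anticomm (xcur 0 e i r) (xcur c e j s)
     - (b i j * epsB + c) *: sbracket (xcur 0 e i r) (xcur c e j s)).

Lemma anticomm0l u : anticomm 0 u = 0 :> A.
Proof. by rewrite /anticomm mul0r mulr0 addr0. Qed.

Lemma anticomm0r u : anticomm u 0 = 0 :> A.
Proof. by rewrite /anticomm mul0r mulr0 addr0. Qed.

Lemma xex_off c e i j r s : i != j -> xex_defect c e i j r s = 0.
Proof.
move=> nij; have nji : j != i by rewrite eq_sym.
have [t [/isshift_even et tr t0 _]] := raising 0 e nij nij.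
have [t' [/isshift_even et' tr' t0' _]] := raising c e nji nji.
elim: r => [|r IH]; last first.
  have := congr1 (ad t) IH; rewrite /xex_defect !(ad0r, adBr, adZr).
  by rewrite !ad_sbracket // !ad_acomm !tr !t0 !sbracket0r !anticomm0r !addr0.
elim: s => [|s IH]; last first.
  have := congr1 (ad t') IH; rewrite /xex_defect !(ad0r, adBr, adZr).
  by rewrite !ad_sbracket // !ad_acomm !tr' !t0' !sbracket0l !anticomm0l !add0r.
have := rel (minimal_xex eps1 eps2 x h e i j);
  rewrite /xex_defect xcur01 xcur1 sbracketDr sbracketZr.
move=> /eqP; rewrite -subr_eq0 => /eqP E; rewrite -[RHS]E /xcur /=.
by nc_ring K A.
Qed.

Lemma serre0 c c' e i j r s : i != j -> cartan_a i j = 0 ->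
  sbracket (xcur c e i r) (xcur c' e j s) = 0.
Proof.
move=> nij a0; have nji : j != i by rewrite eq_sym.
have [t [/isshift_even et tr t0 _]] := raising c e nij nij.
have [t' [/isshift_even et' tr' t0' _]] := raising c' e nji nji.
elim: r => [|r IH]; last first.
  by have := congr1 (ad t) IH; rewrite ad0r ad_sbracket // tr t0 sbracket0r
    addr0.
elim: s => [|s IH]; last first.
  by have := congr1 (ad t') IH; rewrite ad0r ad_sbracket // tr' t0' sbracket0l
    add0r.
by have := rel (minimal_serre eps1 eps2 x h e nij); rewrite a0.
Qed.

Definition xpair c j r s := sbracket (xcur c false j r) (xcur c true j s).

Lemma xpair_even c j r s : even (xpair c j r s).
Proof.
by rewrite /even -[false](addbb (odd_node j)); apply: hcomp_sbracket;
  apply: xcur_par.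
Qed.

Lemma xpair_sgE c j r s : xpair c j r s = xcur c false j r * xcur c true j s
  - sg (odd_node j) *: (xcur c true j s * xcur c false j r).
Proof.
by rewrite /xpair (sbracket_sgE (xcur_par c false j r) (xcur_par c true j s))
  andbb.
Qed.

Lemma shifts_xpair t p q c j r s : shifts t p q ->
  ad t (xpair c j r s) = p j *: (xpair c j r.+1 s - xpair c j r s.+1).
Proof.
move=> st; rewrite ad_sbracket; last by case: st => [[]].
rewrite !(shifts_xcur _ _ _ _ st) expr0 expr1 sbracketZl sbracketZr.
rewrite sbracketDl sbracketDr !sbracketZl !sbracketZr /xpair.
by nc_ring K A.
Qed.

(** The bracket of x^+ and x^- at the node i, indexed so that r is the degree of
    the factor x^e; the other degree w is a parameter. *)
Definition epair e i r w : A := if e then xpair 0 i w r else xpair 0 i r w.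

Lemma epairE e i r w : epair e i r w =
  (if e then - sg (odd_node i) else 1) *:
  (xcur 0 e i r * xcur 0 (~~ e) i w
   - sg (odd_node i) *: (xcur 0 (~~ e) i w * xcur 0 e i r)).
Proof.
rewrite /epair; case: e; rewrite xpair_sgE /=; last by rewrite scale1r.
rewrite scalerBr scalerA mulNr sg_sqr scaleN1r opprK scaleNr.
by rewrite addrC.
Qed.

Lemma xy_scommute c c' e i j r s : i != j ->
  xcur c e j s * xcur c' (~~ e) i r =
  sg (odd_node i && odd_node j) *: (xcur c' (~~ e) i r * xcur c e j s).
Proof.
move=> nij.
case: e => /=; last first.
  rewrite eq_sym in nij; have := xy_off c c' s r nij.
  rewrite (sbracket_sgE (xcur_par c false j s) (xcur_par c' true i r)) andbC.
  by move=> /eqP; rewrite subr_eq0 => /eqP.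
have := xy_off c' c r s nij.
rewrite (sbracket_sgE (xcur_par c' false i r) (xcur_par c true j s)).
move=> /eqP; rewrite subr_eq0 => /eqP ->.
by rewrite scalerA sg_sqr scale1r.
Qed.

Lemma xy_commute c c' e i j r s : i != j -> odd_node i && odd_node j = false ->
  xcur c e j s * xcur c' (~~ e) i r = xcur c' (~~ e) i r * xcur c e j s.
Proof.
by move=> nij oij; rewrite xy_scommute // oij expr0 scale1r.
Qed.

Lemma epair_comm c e i j r w s : i != j -> cartan_a i j = 0 ->
  ad (epair e i r w) (xcur c e j s) = 0.
Proof.
move=> nij a0; rewrite epairE.
have := serre0 0 c e r s nij a0.
rewrite (sbracket_sgE (xcur_par 0 e i r) (xcur_par c e j s)) => /eqP.
rewrite subr_eq0 => /eqP uv; have vy := xy_scommute c 0 e w s nij.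
have [c1 c2] := scomm_product (sg_sqr _) uv vy.
by rewrite adZl adBl adZl c1 c2 scaler0 subrr scaler0.
Qed.

(** The relation of x_{i,r} with the currents of j is bracketed with the
    generator at i opposite to it, which commutes with these currents.  Nodes
    with a_ij = 0 are treated apart, since both may be odd. *)
Lemma hx_off c e i j r s w : i != j ->
  ad (epair e i r.+1 w) (xcur c e j s) - ad (epair e i r w) (xcur c e j s.+1) =
  (sg e * a i j * epsD) *: anticomm (epair e i r w) (xcur c e j s)
  - (b i j * epsB + c) *: ad (epair e i r w) (xcur c e j s).
Proof.
move=> nij; case: (eqVneq (cartan_a i j) 0) => [a0|a0].
  by rewrite !epair_comm // a0 mulr0z mulr0 mul0r scale0r scaler0 !subr0.
have oij := odd_adj hm hn nij a0.
have := xex_off c e r s nij; rewrite /xex_defect.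
have brE r' s' : sbracket (xcur 0 e i r') (xcur c e j s')
    = ad (xcur 0 e i r') (xcur c e j s').
  by rewrite (sbracket_sgE (xcur_par 0 e i r') (xcur_par c e j s')) oij expr0
    scale1r.
rewrite !brE => /eqP; rewrite subr_eq0 => /eqP E.
have c1 := xy_commute c 0 e w s nij oij.
have c2 := xy_commute c 0 e w s.+1 nij oij.
have := current_transfer (sg (odd_node i)) c1 c2 E => /= {}E.
rewrite !epairE; move: E; set f := xcur 0 _ _ _ * _ - _; set f' :=
  xcur 0 _ _ _ * _ - _.
set k := if e then _ else _ => E.
rewrite !adZl -scalerBr E /anticomm.
by nc_ring K A.
Qed.

Lemma quartic0 e i r s : odd_node i ->
  sbracket (sbracket (xcur 0 e (ord_pred i) r) (xcur 0 e i 0))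
           (sbracket (xcur 0 e i 0) (xcur 0 e (ordS i) s)) = 0.
Proof.
move=> oi.
have npi : ord_pred i != i by rewrite eq_sym eq_ord_pred eq_sym ordS_neq.
have nsi : ordS i != i by rewrite ordS_neq.
have nps : ord_pred i != ordS i by rewrite eq_sym eq_ord_pred eq_sym ordSS_neq.
have nsp : ordS i != ord_pred i by rewrite eq_sym.
have [t [/isshift_even et tr t0 t1]] := raising 0 e npi nps.
have [t' [/isshift_even et' tr' t0' t1']] := raising 0 e nsi nsp.
elim: r => [|r IH]; last first.
  have := congr1 (ad t) IH; rewrite ad0r !ad_sbracket // tr t0 t1.
  by rewrite !(sbracket0r, addr0, sbracket0l).
elim: s => [|s IH]; last first.
  have := congr1 (ad t') IH; rewrite ad0r !ad_sbracket // tr' t0' t1'.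
  by rewrite !(sbracket0r, add0r, sbracket0l).
by have := rel (minimal_quartic eps1 eps2 x h e oi).
Qed.

(** By induction, [by_degree k0] says that xpair c j p q depends only on p + q
    for p + q <= k0; the bracket is then the element h_{j,p+q} in degrees at
    most k0. *)
Definition by_degree k0 := forall j c p q, (p + q < k0)%N ->
  xpair c j p.+1 q = xpair c j p q.+1.

Definition hcur i r := xpair 0 i r 0.

Lemma by_degree_sum k0 j c p q : by_degree k0 -> (p + q <= k0)%N ->
  xpair c j p q = xpair c j (p + q) 0.
Proof.
move=> sk; elim: q p => [|q IH] p; first by rewrite addn0.
by rewrite addnS => lt; rewrite -sk // IH ?addSn.
Qed.

Lemma by_degree_eq k0 j c p q p' q' : by_degree k0 -> (p + q <= k0)%N ->
  (p + q = p' + q')%N -> xpair c j p q = xpair c j p' q'.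
Proof.
by move=> sk le E; rewrite (by_degree_sum _ _ sk le) E -(by_degree_sum _ _ sk)
  // -E.
Qed.

Lemma by_degree_epair k0 e i r : by_degree k0 -> (r <= k0)%N ->
  epair e i r 0 = hcur i r.
Proof.
by move=> sk le; case: e => //=; rewrite /epair (by_degree_sum _ _ sk).
Qed.

Lemma hcur0 i : hcur i 0 = h i 0.
Proof. by have := rel (minimal_x0x0 eps1 eps2 x h i i); rewrite eqxx. Qed.

Lemma xpair10 c j : xpair c j 1 0 = h j 1 + c *: h j 0.
Proof.
rewrite /xpair xcur1 sbracketDl sbracketZl /xcur /= -[sbracket (x false j 0)
  _]/(hcur j 0) hcur0.
congr (_ + _); by have := rel (minimal_x1x0 eps1 eps2 x h j j); rewrite eqxx.
Qed.

Lemma xpair01 c j : xpair c j 0 1 = h j 1 + c *: h j 0.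
Proof.
rewrite /xpair xcur1 sbracketDr sbracketZr /xcur /=.
rewrite -[sbracket (x false j 0) (x true j 0)]/(hcur j 0) hcur0.
congr (_ + _); by have := rel (minimal_x0x1 eps1 eps2 x h j j); rewrite eqxx.
Qed.

Lemma ad_h0_xcur c e i j s :
  ad (h i 0) (xcur c e j s) = (sg e * a i j) *: xcur c e j s.
Proof. by rewrite (shifts_xcur _ _ _ _ (shifts_h0 i)); nc_ring K A. Qed.

Lemma ad_h0_xpair i c j p q : ad (h i 0) (xpair c j p q) = 0.
Proof. by rewrite (shifts_xpair _ _ _ _ (shifts_h0 i)) scale0r. Qed.

Lemma adT_xpair c j p q :
  ad (T j) (xpair c j p q) = xpair c j p.+1 q - xpair c j p q.+1.
Proof.
by rewrite (shifts_xpair _ _ _ _ (T_shifts j)) eqxx eq_sym ordS_neq // subr0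
  scale1r.
Qed.

Definition hx_rel k0 c i j := forall e r s, (r < k0)%N ->
  ad (hcur i r.+1) (xcur c e j s) - ad (hcur i r) (xcur c e j s.+1) =
  (sg e * a i j * epsD) *: anticomm (hcur i r) (xcur c e j s)
  - (b i j * epsB + c) *: ad (hcur i r) (xcur c e j s).

Lemma hx_rel_off k0 c i j : by_degree k0 -> i != j -> hx_rel k0 c i j.
Proof.
move=> sk nij e r s ltr; have := hx_off c e r s 0 nij.
by rewrite !(by_degree_epair _ _ sk) // ltnW.
Qed.

(** For c = a_ij (eps1 + eps2)/2 - b_ij (eps1 - eps2)/2 the anticommutator in
    [hx_rel] combines with the bracket to a product with h_{i,r} on the right
    (for x^+) or on the left (for x^-), as [ad_current_pair] requires.  Its
    commutation hypothesis concerns total degree at most k0, where the right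
    side of the statement vanishes; hence the induction on k. *)
Lemma ad_hcur_xpair k0 c i j k s w : by_degree k0 -> hx_rel k0 c i j ->
  c = a i j * epsD - b i j * epsB -> (k <= k0)%N -> (s + w + k <= k0.+1)%N ->
  ad (hcur i k) (xpair c j s w) =
  a i j *: (xpair c j (s + k) w - xpair c j s (w + k)).
Proof.
move=> sk hx cE; have [k'] := ubnP k; elim: k' k s w =>
  // k' IH k s w ltk lek les.
have cur p q : xpair c j p q
    = current_pair (sg (odd_node j)) (xcur c false j) (xcur c true j) p q.
  exact: xpair_sgE.
rewrite !cur (@ad_current_pair K A (a i j) (epsD + epsD) _ (hcur i) _ _ k0) //.
- by move=> s'; rewrite hcur0 ad_h0_xcur expr0 mul1r.
- by move=> s'; rewrite hcur0 ad_h0_xcur expr1 mulN1r.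
- move=> r s' ltr; have := hx false r s' ltr.
  rewrite /anticomm => /eqP; rewrite subr_eq => /eqP ->.
  by rewrite /ad expr0 cE; nc_ring K A.
- move=> r s' ltr; have := hx true r s' ltr.
  rewrite /anticomm => /eqP; rewrite subr_eq => /eqP ->.
  by rewrite /ad expr1 cE; nc_ring K A.
move=> p ltp; rewrite -!cur (@by_degree_eq k0 j c (s + p) w s (w + p)) //;
  try lia.
apply/eqP; rewrite -subr_eq0 -oppr_eq0 opprB; apply/eqP.
rewrite -[LHS]/(ad (hcur i (k - p.+1)) (xpair c j s (w + p))) IH //; try lia.
rewrite (@by_degree_eq k0 j c (s + (k - p.+1)) (w + p) s (w + p + (k - p.+1)))
  //; try lia.
by rewrite subrr scaler0.
Qed.

(** T j maps xpair c j p q to the difference of two neighbours in degree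
    p + q + 1. *)
Lemma by_degree_step k0 : by_degree k0 ->
  (forall j c, ad (T j) (xpair c j k0 0) = 0) -> by_degree k0.+1.
Proof.
move=> sk T0 j c p q; rewrite ltnS leq_eqVlt => /orP[/eqP E|]; last exact: sk.
apply/eqP; rewrite -subr_eq0 -adT_xpair; apply/eqP.
by rewrite (by_degree_sum _ _ sk) ?E.
Qed.

(** In degree 1 this is the pair of relations defining h_{j,1}; in degree 2 it
    holds because h_{j,1} and h_{j,0} commute with T j. *)
Lemma by_degree_two : by_degree 2.
Proof.
have s1 : by_degree 1.
  by apply: by_degree_step => // j c; rewrite adT_xpair xpair10 xpair01 subrr.
apply: by_degree_step => // j c; have [tT _] := T_shifts j.
by rewrite xpair10 adDr adZr !torus_comm ?scaler0 ?addr0 //; apply: torus_h.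
Qed.

(** The obstruction to passing from degree k to degree k + 1. *)
Definition defect j k := ad (T j) (hcur j k).

Lemma defect_change k0 j c :
  by_degree k0 -> ad (T j) (xpair c j k0 0) = defect j k0.
Proof.
move=> sk; apply/eqP; rewrite -subr_eq0 -adBr; apply/eqP.
have -> : xpair c j k0 0 - hcur j k0
  = sbracket (xcur c false j k0 - xcur 0 false j k0) (x true j 0).
  by rewrite sbracketBl.
apply: (@xcur_change (fun u => ad (T j) (sbracket u (x true j 0)) = 0)).
- by rewrite sbracket0l ad0r.
- by move=> d u v Pu Pv; rewrite sbracket_linl adDr adZr Pu Pv scaler0 addr0.
move=> l ltl; rewrite -[sbracket _ _]/(xpair 0 j l 0) adT_xpair sk ?subrr //.
by rewrite addn0.
Qed.

Lemma ad_h1_hcur i j k :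
  ad (h j 1) (hcur i k) = a j i *: (xpair 0 i k.+1 0 - xpair 0 i k 1).
Proof.
have -> : h j 1 = htilde1 eps1 eps2 h j + epsD *: (h j 0 * h j 0).
  by rewrite /htilde1 expr2 subrK.
rewrite adDl adZl adMl !ad_h0_xpair mulr0 mul0r addr0 scaler0 addr0.
by rewrite (shifts_xpair _ _ _ _ (shifts_htilde j)).
Qed.

(** The commutator of hcur i k with xpair c j 1 0 = h_{j,1} + c h_{j,0} in two
    ways: as k steps of the arithmetic progression formed by the xpair c j p q
    with p + q = k + 1, and through the action of h_{j,1} on the node i. *)
Lemma defect_adj k i j : by_degree k -> i != j -> cartan_a i j != 0 ->
  k%:R *: defect j k + defect i k = 0.
Proof.
move=> sk nij a0; pose c := a i j * epsD - b i j * epsB.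
have telescope p : (p <= k)%N ->
    xpair c j p.+1 (k - p) = xpair c j 1 k + p%:R *: defect j k.
  elim: p => [|p IH] lep; first by rewrite subn0 scale0r addr0.
  have := adT_xpair c j p.+1 (k - p.+1).
  rewrite (by_degree_sum _ _ sk) ?subnKC // defect_change //.
  have -> : ((k - p.+1).+1 = k - p)%N by lia.
  move=> /eqP; rewrite eq_sym subr_eq => /eqP ->.
  by rewrite IH 1?ltnW // -natr1; nc_ring K A.
have := @ad_hcur_xpair k c i j k 1 0 sk (hx_rel_off c sk nij) erefl (leqnn k)
  (leqnn _).
rewrite add1n add0n; have := telescope k (leqnn k); rewrite subnn => ->.
rewrite adC xpair10 adDl adZl ad_h0_xpair scaler0 addr0 ad_h1_hcur -adT_xpair.
rewrite -/(hcur i k) -/(defect i k) (cartan_aC hm hn j i) => E.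
have sa : a i j * a i j = 1 by rewrite -intrM -expr2 sqr_cartan_adj.
have -> : k%:R *: defect j k + defect i k
    = a i j *: (a i j *: (xpair c j 1 k + k%:R *: defect j k - xpair c j 1 k)
                - - (a i j *: defect i k)).
  transitivity ((a i j * a i j) *: (k%:R *: defect j k + defect i k)).
    by rewrite sa scale1r.
  by nc_ring K A.
by rewrite E subrr scaler0.
Qed.

Lemma defect0 k j : (2 <= k)%N -> by_degree k -> defect j k = 0.
Proof.
move=> k2 sk; have nij : ordS j != j by rewrite ordS_neq.
have nji : j != ordS j by rewrite eq_sym.
have aji := cartan_next_neq0 hm hn j.
have aij : cartan_a (ordS j) j != 0 by rewrite cartan_aC.
have E1 := defect_adj sk nij aij; have E2 := defect_adj sk nji aji.
have E : ((k * k)%:R - 1) *: defect j k = 0.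
  rewrite natrM.
  transitivity (k%:R *: (k%:R *: defect j k + defect (ordS j) k)
    - (k%:R *: defect (ordS j) k + defect j k)); first by nc_ring K A.
  by rewrite E1 E2 scaler0 subrr.
move/eqP: E; rewrite scaler_eq0 subr_eq0 => /orP[/eqP E|/eqP //].
by have := natr_inj_char0 char0 (E : (k * k)%:R = 1%:R); nia.
Qed.

Lemma by_degree_all k : by_degree k.
Proof.
have s k' : by_degree k'.+2.
  elim: k' => [|k' IH]; first exact: by_degree_two.
  by apply: by_degree_step => // j c; rewrite defect_change // defect0.
by move=> j c p q lt; apply: (s k); lia.
Qed.

Lemma two_neq0 : (2%:R : K) != 0.
Proof. by rewrite (natr_eq0_char0 char0). Qed.

Lemma three_neq0 : (3%:R : K) != 0.
Proof. by rewrite (natr_eq0_char0 char0). Qed.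

Lemma xpairE j p q : xpair 0 j p q = hcur j (p + q).
Proof. exact: (by_degree_sum _ _ (@by_degree_all (p + q))). Qed.

Lemma epairE0 e i r : epair e i r 0 = hcur i r.
Proof. exact: (by_degree_epair _ _ (@by_degree_all r)). Qed.

Lemma shift_hcur t i r : isshift t -> ad t (hcur i r) = 0.
Proof.
by move=> [p [q st]]; rewrite (shifts_xpair _ _ _ _ st) !xpairE addn0 addn1
  subrr scaler0.
Qed.

Lemma hcur_even i r : even (hcur i r).
Proof. exact: xpair_even. Qed.

Lemma isshift_torus t : isshift t -> torus t.
Proof. by case=> p [q []]. Qed.

(** The element of [quadratic_shift], for a neighbour k of i that is not
    adjacent to j, acts on x_{i,0} by a quadratic polynomial in the shift, and
    trivially at j.  The terms of degree at most one of this polynomial are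
    cancelled by elements that shift the degree by one and by zero. *)
Lemma raise_two e i j : i != j -> cartan_a i j != 0 -> exists t, [/\ even t,
  forall s, ad t (xcur 0 e i s) = xcur 0 e i s.+2 &
  forall s, ad t (xcur 0 e j s) = 0].
Proof.
move=> nij aij; have [k [nki nkj aki akj]] := far_neighbour hm hn nij aij.
pose ek := sg e * a k i; pose C := epsD + epsD.
pose c := ek * epsD - b k i * epsB.
have ee : ek * ek = 1.
  by rewrite /ek mulrACA sg_sqr mul1r -intrM -expr2 sqr_cartan_adj.
have d0 s : ad (hcur k 0) (xcur c e i s) = ek *: xcur c e i s.
  by rewrite hcur0 ad_h0_xcur.
have dS r s : ad (hcur k r.+1) (xcur c e i s)
    = ad (hcur k r) (xcur c e i s.+1) + (ek * C) *: (xcur c e i s * hcur k r).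
  have := hx_rel_off c (@by_degree_all r.+1) nki e s (ltnSn r).
  rewrite -/ek /anticomm /ad => /eqP; rewrite subr_eq => /eqP ->.
  by rewrite /c /C; nc_ring K A.
have d1 s : ad (hcur k 1) (xcur c e i s)
    = ek *: xcur c e i s.+1 + (ek * C) *: (xcur c e i s * hcur k 0).
  by rewrite dS d0.
have d2 : ad (hcur k 2) (xcur c e i 0) = ek *: xcur c e i 2
    + (ek * C) *: (xcur c e i 1 * hcur k 0 + xcur c e i 0 * hcur k 1).
  by rewrite dS d1; nc_ring K A.
have := quadratic_shift three_neq0 ee (d0 0%N) (d0 1%N) (d1 0%N) d2.
set P := _ + _ => dP.
have [r [sr rr rj _]] := raising 0 e nij nij.
have [w [sw wi wj _]] := weighing e nij nij.
have er := isshift_even sr; have ew := isshift_even sw.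
have X1 : xcur c e i 1 = xcur 0 e i 1 + c *: xcur 0 e i 0.
  by rewrite xcur01 xcur1.
have X2 : xcur c e i 2
    = xcur 0 e i 2 + (c + c) *: xcur 0 e i 1 + (c * c) *: xcur 0 e i 0.
  rewrite (xcur_shift c 0) X1 raiseD raiseZ -!/(xcur 0 e i _.+1) /xcur /=.
  by nc_ring K A.
(* The coefficients of P on xcur 0 e i 1 and xcur 0 e i 0, by X1 and X2. *)
pose t := ek *: (P - (ek * (c + c) - C) *: r
  - (ek * (c * c) - C * c + ek * C ^+ 2 / 3) *: w).
have rP : ad r P = 0.
  by rewrite /P adDr adBr !adZr !adM !shift_hcur // !(mul0r, mulr0, scaler0,
    addr0, subrr).
have rt : ad t r = 0.
  rewrite adC adZr !adBr !adZr rP (torus_comm (isshift_torus sr) (isshift_torus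
    sr)).
  rewrite (torus_comm (isshift_torus sr) (isshift_torus sw)).
  by rewrite !scaler0 !subrr scaler0 oppr0.
have t0 : ad t (xcur 0 e i 0) = xcur 0 e i 2.
  rewrite /t adZl !adBl !adZl rr wi -[X in ad P X]/(xcur c e i 0) dP X1 X2
    /xcur.
  transitivity ((ek * ek) *: xcur 0 e i 2); last by rewrite ee scale1r.
  by rewrite /xcur; nc_ring K A.
exists t; split.
- apply: evenZ; apply: evenD; last by apply/evenN/evenZ.
  apply: evenD; last by apply/evenN/evenZ.
  rewrite /P; apply: evenD; [apply: evenD|]; rewrite -?scaleNr;
    repeat (apply: evenZ || apply: evenM || exact: hcur_even).
- by elim=> [//|s IH]; rewrite -rr (ad_ad _ rt) IH rr.
move=> s; rewrite adZl !adBl !adZl rj wj /P adDl adBl !adZl !adMl.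
have hj s' : ad (hcur k s') (xcur 0 e j s) = 0 by rewrite -(epairE0 e)
  epair_comm.
by rewrite !hj !(mulr0, mul0r, addr0, scaler0, subrr).
Qed.

Lemma next_neq i : i != ordS i.
Proof. by rewrite eq_sym ordS_neq. Qed.

Lemma xx_odd e i r s : odd_node i -> sbracket (xcur 0 e i r) (xcur 0 e i s) = 0.
Proof.
move=> oi; have nij := next_neq i.
have [t [/isshift_even et tr _ _]] := raising 0 e nij nij.
have [t2 [et2 tr2 _]] := raise_two e nij (cartan_next_neq0 hm hn i).
apply: (symmetric_vanish (F := fun r s => sbracket (xcur 0 e i r) (xcur 0 e i
  s)) two_neq0).
- move=> r' s'; rewrite !(sbracket_sgE (xcur_par 0 e i _) (xcur_par 0 e i _)) oi
    /=.
  by rewrite expr1; nc_ring K A.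
- by apply: rel; constructor.
- by move=> r' s' F0; rewrite -!tr -ad_sbracket // F0 ad0r.
- by move=> r' s' F0; rewrite -!tr2 -ad_sbracket // F0 ad0r.
Qed.

(** The Cartan numbers b_ii vanish and the defect is symmetric in r and s, so
    raising through the power sums is enough; at an odd node the relation says
    nothing beyond [xx_odd]. *)
Lemma xex_diag e i r s : xex_defect 0 e i i r s = 0.
Proof.
have [oi|ei] := boolP (odd_node i).
  rewrite /xex_defect !xx_odd //; move: oi; rewrite odd_cartan // => /eqP ->.
  by rewrite mulr0z mulr0 mul0r scale0r scaler0 !subrr.
have nij := next_neq i.
have [t [/isshift_even et tr _ _]] := raising 0 e nij nij.
have [t2 [et2 tr2 _]] := raise_two e nij (cartan_next_neq0 hm hn i).
have step u d : even u -> (forall s', ad u (xcur 0 e i s') = xcur 0 e i (d +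
  s')) ->
  forall r' s', xex_defect 0 e i i r' s' = 0 ->
    xex_defect 0 e i i (d + r') s' + xex_defect 0 e i i r' (d + s') = 0.
  move=> eu du r' s' /(congr1 (ad u)); rewrite ad0r => <-.
  rewrite /xex_defect !adBr !adZr !ad_acomm !ad_sbracket // !du !addnS.
  by nc_ring K A.
apply: (symmetric_vanish (F := fun r s => xex_defect 0 e i i r s) two_neq0).
- move=> r' s'; rewrite /xex_defect cartan_b_self // mulr0z mul0r addr0
    !scale0r.
  rewrite !(sbracket_sgE (xcur_par 0 e i _) (xcur_par 0 e i _)) (negbTE ei)
    expr0.
  by rewrite /anticomm; nc_ring K A.
- have := rel (minimal_xex eps1 eps2 x h e i i).
  by rewrite /xex_defect !xcur01 addr0 => /eqP; rewrite -subr_eq0 => /eqP.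
- exact: (step t 1%N).
- exact: (step t2 2%N).
Qed.

Definition serre_sum e i j r1 r2 s :=
  sbracket (xcur 0 e i r1) (sbracket (xcur 0 e i r2) (xcur 0 e j s))
  + sbracket (xcur 0 e i r2) (sbracket (xcur 0 e i r1) (xcur 0 e j s)).

(** The degree at j is raised first, with both degrees at i equal to zero, and
    then the two degrees at i through the power sums. *)
Lemma serre1 e i j r1 r2 s : i != j -> cartan_a i j != 0 ->
  serre_sum e i j r1 r2 s = 0.
Proof.
move=> nij aij; have nji : j != i by rewrite eq_sym.
have [//|[_ a1]] := absz_cartan hm hn nij.
  by move=> a0; rewrite a0 eqxx in aij.
have [t [/isshift_even et tr t0 _]] := raising 0 e nij nij.
have [t' [/isshift_even et' tr' t0' _]] := raising 0 e nji nji.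
have [t2 [et2 tr2 t20]] := raise_two e nij aij.
apply: (symmetric_vanish (F := fun r1 r2 => serre_sum e i j r1 r2 s) two_neq0).
- by move=> r s'; rewrite /serre_sum addrC.
- rewrite /serre_sum.
  suff -> : sbracket (xcur 0 e i 0) (sbracket (xcur 0 e i 0) (xcur 0 e j s)) = 0
    by rewrite addr0.
  elim: s => [|s IH]; last first.
    have := congr1 (ad t') IH; rewrite ad0r !ad_sbracket // tr' t0'.
    by rewrite !(sbracket0l, add0r).
  by have := rel (minimal_serre eps1 eps2 x h e nij); rewrite a1.
- move=> r s' /(congr1 (ad t)); rewrite ad0r => <-.
  rewrite /serre_sum !adDr !ad_sbracket // !tr !t0 !sbracket0r !addr0.
  by nc_ring K A.
- move=> r s' /(congr1 (ad t2)); rewrite ad0r => <-.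
  rewrite /serre_sum !adDr !ad_sbracket // !tr2 !t20 !sbracket0r !addr0.
  by nc_ring K A.
Qed.

Lemma hcur1 i : hcur i 1 = h i 1.
Proof. by rewrite /hcur xpair10 scale0r addr0. Qed.

Lemma hx_level0 e i j s :
  ad (hcur i 1) (xcur 0 e j s) - ad (hcur i 0) (xcur 0 e j s.+1) =
  (sg e * a i j * epsD) *: anticomm (hcur i 0) (xcur 0 e j s)
  - (b i j * epsB) *: ad (hcur i 0) (xcur 0 e j s).
Proof.
have E : hcur i 1 = htilde1 eps1 eps2 h i + epsD *: (hcur i 0 * hcur i 0).
  by rewrite hcur1 hcur0 /htilde1 expr2 subrK.
rewrite E adDl (shifts_xcur _ _ _ _ (shifts_htilde i)) adZl adMl hcur0
  !ad_h0_xcur.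
by rewrite /anticomm; nc_ring K A.
Qed.

(** Bracketing the relation of x_{i,r} and x_{i,s} with the opposite generator y
    replaces each factor by h in turn, and gives the sum of the defects for
    (r, s) and (s, r).  So the defect, which vanishes for r = 0, vanishes for
    s = 0, and the degree s can then be raised since the shifts commute with
    the h_{i,r}. *)
Lemma hx_diag e i r s :
  ad (hcur i r.+1) (xcur 0 e i s) - ad (hcur i r) (xcur 0 e i s.+1) =
  (sg e * a i i * epsD) *: anticomm (hcur i r) (xcur 0 e i s).
Proof.
have nij := next_neq i.
have [t [st tr _ _]] := raising 0 e nij nij.
pose al := sg e * a i i * epsD.
pose y := xcur 0 (~~ e) i 0.
have hE r' : hcur i r' = (if e then - sg (odd_node i) else 1) *:
    (xcur 0 e i r' * y - sg (odd_node i) *: (y * xcur 0 e i r')).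
  by rewrite -epairE epairE0.
have [oi|ei] := boolP (odd_node i).
  have a0 : a i i = 0 by move: oi; rewrite odd_cartan // => /eqP ->.
  suff K0 r' s' : ad (hcur i r') (xcur 0 e i s') = 0.
    by rewrite !K0 a0 mulr0 mul0r scale0r subrr.
  have KC r1 r2 : ad (hcur i r1) (xcur 0 e i r2) = - ad (hcur i r2) (xcur 0 e i
    r1).
    have xx : xcur 0 e i r1 * xcur 0 e i r2 = - (xcur 0 e i r2 * xcur 0 e i r1).
      have := xx_odd e r1 r2 oi.
      rewrite (sbracket_sgE (xcur_par 0 e i _) (xcur_par 0 e i _)) oi expr1.
      by rewrite scaleN1r opprK => /eqP; rewrite addr_eq0 => /eqP.
    apply/eqP; rewrite -addr_eq0; apply/eqP.
    pose f := xcur 0 e i r1 * xcur 0 e i r2 + xcur 0 e i r2 * xcur 0 e i r1.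
    have f0 : f = 0 by rewrite /f xx addNr.
    transitivity ((if e then - sg (odd_node i) else 1) *: (y * f - f * y)).
      by rewrite !hE oi expr1 /ad /f; nc_ring K A.
    by rewrite f0 mulr0 mul0r subrr scaler0.
  elim: s' => [|s' IH].
    by rewrite KC hcur0 ad_h0_xcur a0 mulr0 scale0r oppr0.
  rewrite -tr ad_ad; first by rewrite IH ad0r.
  by rewrite adC shift_hcur ?oppr0.
pose HX r' s' := ad (hcur i r'.+1) (xcur 0 e i s') - ad (hcur i r') (xcur 0 e i
  s'.+1)
   - al *: anticomm (hcur i r') (xcur 0 e i s').
suff HX0 : HX r s = 0 by apply/eqP; rewrite -subr_eq0; apply/eqP.
have HXC r1 r2 : HX r1 r2 = - HX r2 r1.
  apply/eqP; rewrite -addr_eq0; apply/eqP.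
  have := xex_diag e i r1 r2.
  rewrite /xex_defect cartan_b_self // mulr0z mul0r addr0 !scale0r.
  rewrite !(sbracket_sgE (xcur_par 0 e i _) (xcur_par 0 e i _)) (negbTE ei)
    expr0 -/al.
  set f := _ - _ => f0.
  transitivity ((if e then -1 else 1 : K) *: (f * y - y * f)).
    rewrite /HX !hE (negbTE ei) expr0 /ad /f /anticomm.
    by case: (e); nc_ring K A.
  by rewrite f0 mulr0 mul0r subrr scaler0.
have HX00 s' : HX 0%N s' = 0.
  by rewrite /HX hx_level0 cartan_b_self // mulr0z mul0r scale0r subr0 subrr.
elim: s => [|s IH]; first by rewrite HXC HX00 oppr0.
have := congr1 (ad t) IH; rewrite ad0r /HX !adBr adZr ad_acomm !adM.
by rewrite !tr !shift_hcur // anticomm0l !(mul0r, mulr0, add0r, addr0).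
Qed.

Lemma hx_all e i j r s :
  ad (hcur i r.+1) (xcur 0 e j s) - ad (hcur i r) (xcur 0 e j s.+1) =
  (sg e * a i j * epsD) *: anticomm (hcur i r) (xcur 0 e j s)
  - (b i j * epsB) *: ad (hcur i r) (xcur 0 e j s).
Proof.
have [<-|nij] := eqVneq i j.
  by rewrite hx_diag cartan_b_self // mulr0z mul0r scale0r subr0.
by have := hx_rel_off 0 (@by_degree_all r.+1) nij e s (ltnSn r); rewrite addr0.
Qed.

(** The relation is linear in the current once its shift is written with
    [raise], so it passes from the parameter 0 to all parameters. *)
Lemma hx_rel_all k0 c i j : hx_rel k0 c i j.
Proof.
move=> e r s _.
pose f u := ad (hcur i r.+1) u - ad (hcur i r) (raise 0 e j u)
  - ((sg e * a i j * epsD) *: anticomm (hcur i r) u - (b i j * epsB) *: ad (hcur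
      i r) u).
have f0 : f (xcur c e j s) = 0.
  apply: (@xcur_span (fun u => f u = 0) 0 c).
  - by rewrite /f /raise !(ad0r, scaler0, addr0, anticomm0r, subrr).
  - move=> d u v fu fv; transitivity (d *: f u + f v);
      last by rewrite fu fv scaler0 addr0.
    by rewrite /f /raise /anticomm /ad; nc_ring K A.
  - by move=> l _; rewrite /f hx_all subrr.
have xr : xcur c e j s.+1 = raise 0 e j (xcur c e j s) + c *: xcur c e j s.
  by rewrite (xcur_shift c 0) subr0.
apply/eqP; rewrite -subr_eq0 xr adDr adZr; apply/eqP; rewrite -[RHS]f0 /f.
by nc_ring K A.
Qed.

Lemma hcur_comm i j r s : ad (hcur i r) (hcur j s) = 0.
Proof.
pose c := a i j * epsD - b i j * epsB.
apply: (@xcur_span (fun u => ad (hcur i r) (sbracket u (x true j 0)) = 0) c 0).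
- by rewrite sbracket0l ad0r.
- by move=> d u v Pu Pv; rewrite sbracket_linl adDr adZr Pu Pv scaler0 addr0.
move=> l _; rewrite -[sbracket _ _]/(xpair c j l 0).
rewrite (@ad_hcur_xpair (l + r) c i j r l 0 (@by_degree_all _) (@hx_rel_all _ c
  i j) erefl); try lia.
by rewrite (by_degree_eq j c (@by_degree_all (l + r)) (p' := l) (q' :=
  r)) ?addn0 // subrr scaler0.
Qed.

(** For a_ij = +-1 the two permutations contribute the two terms of [serre_sum];
    pairing w with its product by the transposition avoids listing them. *)
Lemma yangian_serre_sum e i j N (r : 'I_(1 + N) -> nat) s : i != j ->
  absz (cartan_a i j) = N ->
  \sum_(w : 'S_(1 + N)) foldr (fun k u => sbracket (xcur 0 e i (r (w k))) u)
    (xcur 0 e j s) (enum 'I_(1 + N)) = 0.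
Proof.
move=> nij; have [a0|[aij ->]] := absz_cartan hm hn nij.
  rewrite a0 => N0; rewrite -N0 in r *; apply: big1 => w _.
  by rewrite enum_ordSl /= (size0nil (size_enum_ord 0)) /= serre0.
move=> N1; rewrite -N1 in r *.
pose f (w : 'S_2) := sbracket (xcur 0 e i (r (w ord0)))
  (sbracket (xcur 0 e i (r (w ord_max))) (xcur 0 e j s)).
transitivity (\sum_w f w).
  apply: eq_bigr => w _; rewrite enum_ordSl enum_ordSl /=.
  rewrite (size0nil (size_enum_ord 0)) /= /f.
  by congr (sbracket _ (sbracket (xcur 0 e i (r (w _))) _)); apply: val_inj.
have E : \sum_w f w + \sum_w f w = 0.
  rewrite {2}(reindex_inj (mulgI (tperm ord0 ord_max))) -big_split /=.
  apply: big1 => w _; rewrite /f !permM tpermL tpermR.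
  exact: serre1.
have : (2%:R : K) *: \sum_w f w = 0 by rewrite scaler_nat mulr2n.
by move/eqP; rewrite scaler_eq0 (negbTE two_neq0) => /eqP.
Qed.

Lemma yangian_relations_hold u v :
  yangian_rel eps1 eps2 (xcur 0) hcur u v -> u = v.
Proof.
case=> {u v} [i j r s|i j r s|e i j r|e i j r s|e i j r s|e i j r s nij|e i r s
  oi|e i r s oi].
- by rewrite (sbracket_even _ (hcur_even i r)) hcur_comm.
- have [<-|nij] := eqVneq i j; last exact: xy_off.
  exact: xpairE.
- by rewrite (sbracket_even _ (hcur_even i 0)) hcur0 ad_h0_xcur.
- by rewrite !(sbracket_even _ (hcur_even i _)) hx_all.
- apply/eqP; rewrite -subr_eq0; apply/eqP.
  have [<-|nij] := eqVneq i j.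
    by have := xex_diag e i r s; rewrite /xex_defect addr0.
  by have := xex_off 0 e r s nij; rewrite /xex_defect addr0.
- exact: yangian_serre_sum.
- exact: xx_odd.
- exact: quartic0.
Qed.

End Currents.

(** The extended family consists of the currents with parameter 0, for one
    choice of the shifts T, and of the brackets of x^+_{i,r} and x^-_{i,0}. *)
Lemma minimal_extends : exists x' h',
  [/\ forall e i (r : 'I_2), x' e i (r : nat) = x e i r,
      forall i (r : 'I_2), h' i (r : nat) = h i r,
      (forall e i r, hcomp (odd_node i) (x' e i r) = x' e i r)
      /\ (forall i r, even (h' i r)) &
      forall u v, yangian_rel eps1 eps2 x' h' u v -> u = v].
Proof.
have [|T T_shifts] := @boolp.choice _ _ (fun (j : 'I_(m + n)) t => shifts t
    (fun k => (k == j)%:R - (k == ordS j)%:R) (fun=> 0)).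
  move=> j; apply: shifts_exists; last by rewrite big1.
  rewrite sumrB; have d i : \sum_j0 (j0 == i)%:R = 1 :> K.
    by rewrite (bigD1 i) //= eqxx big1 ?addr0 // => l /negbTE ->.
  by rewrite !d subrr.
have two (P : 'I_2 -> Prop) : P 0 -> P 1 -> forall r, P r.
  move=> P0 P1 [[|[|r]] lt] //.
    by have -> : Ordinal lt = 0 by apply: val_inj.
  by have -> : Ordinal lt = 1 by apply: val_inj.
exists (xcur T 0), (hcur T); split.
- by move=> e i; apply: two => //; apply: xcur01.
- by move=> i; apply: two; [apply: hcur0|apply: hcur1].
- by split=> *; [apply: xcur_par|apply: hcur_even].
- exact: yangian_relations_hold.
Qed.

End Minimal.

(** * Transport of the relations, and Yangian families *)

Section Transport.
Context (K : fieldType) (m n : nat) (eps1 eps2 : K) (A B : superAlgType K).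
Context (f : {lrmorphism A -> B}).
Hypothesis f_hcomp : forall p u, f (hcomp p u) = hcomp p (f u).

Lemma lrmorph_sbracket u v : f (sbracket u v) = sbracket (f u) (f v).
Proof.
rewrite /sbracket raddf_sum; apply: eq_bigr => p _ /=.
rewrite raddf_sum; apply: eq_bigr => q _ /=.
by rewrite rmorphB !rmorphM /= rmorph_sign !f_hcomp.
Qed.

Lemma lrmorph_anticomm u v : f (anticomm u v) = anticomm (f u) (f v).
Proof. by rewrite /anticomm rmorphD !rmorphM. Qed.

Lemma lrmorph_scale k u : f (k *: u) = k *: f u.
Proof. exact: linearZ. Qed.

Lemma lrmorph_sub u v : f (u - v) = f u - f v.
Proof. exact: rmorphB. Qed.

Lemma lrmorph_natmul u k : f (u *+ k) = f u *+ k.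
Proof. exact: rmorphMn. Qed.

Lemma lrmorph_exp u k : f (u ^+ k) = f u ^+ k.
Proof. exact: rmorphXn. Qed.

Lemma lrmorph_foldr (I : Type) (s : seq I) (g : I -> A) u :
  f (foldr (fun k y => sbracket (g k) y) u s)
  = foldr (fun k y => sbracket (f (g k)) y) (f u) s.
Proof. by elim: s => //= k s IH; rewrite lrmorph_sbracket IH. Qed.

Lemma lrmorph_iter k u v :
  f (iter k (sbracket u) v) = iter k (sbracket (f u)) (f v).
Proof. by elim: k => //= k IH; rewrite lrmorph_sbracket IH. Qed.

Let fE := (lrmorph_sbracket, lrmorph_anticomm, lrmorph_scale, lrmorph_sub,
  lrmorph_natmul, lrmorph_exp, lrmorph_iter).

Section YangianTransport.
Context (x : bool -> 'I_(m + n) -> nat -> A) (h : 'I_(m + n) -> nat -> A).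
Local Notation fx := (fun e i r => f (x e i r)).
Local Notation fh := (fun i r => f (h i r)).

Lemma lrmorph_serre e i j N (r : 'I_(1 + N) -> nat) s :
  f (\sum_(w : 'S_(1 + N)) foldr (fun k y => sbracket (x e i (r (w k))) y)
      (x e j s) (enum 'I_(1 + N)))
  = \sum_(w : 'S_(1 + N)) foldr (fun k y => sbracket (fx e i (r (w k))) y)
      (fx e j s) (enum 'I_(1 + N)).
Proof. by rewrite raddf_sum; apply: eq_bigr => w _ /=;
  rewrite lrmorph_foldr. Qed.

Lemma yangian_rel_map u v : yangian_rel eps1 eps2 x h u v ->
  yangian_rel eps1 eps2 fx fh (f u) (f v).
Proof.
case=> [i j r s|i j r s|e i j r|e i j r s|e i j r s|e i j r s nij|e i r s oi|e i
  r s oi];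
  rewrite ?lrmorph_serre ?fE ?rmorph0.
- exact: yangian_hh.
- exact: yangian_xx.
- exact: (yangian_h0x _ _ fx fh).
- exact: (yangian_hx _ _ fx fh).
- exact: (yangian_xex _ _ fx fh).
- exact: (yangian_serre _ _ _ fh).
- exact: (yangian_odd _ _ fx fh).
- exact: (yangian_quartic _ _ fx fh).
Qed.

(** Each relation between the images is the image of the same relation. *)
Lemma yangian_rel_lift u v : yangian_rel eps1 eps2 fx fh u v ->
  exists u' v', [/\ yangian_rel eps1 eps2 x h u' v', f u' = u & f v' = v].
Proof.
case=> [i j r s|i j r s|e i j r|e i j r s|e i j r s|e i j r s nij|e i r s oi|e i
  r s oi];
  do 2 eexists; split.
- exact: (yangian_hh eps1 eps2 x h i j r s). - by rewrite !fE. - exact: rmorph0.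
- exact: (yangian_xx eps1 eps2 x h i j r s). - by rewrite !fE. - by rewrite !fE.
- exact: (yangian_h0x eps1 eps2 x h e i j r). - by rewrite !fE. - by rewrite
    !fE.
- exact: (yangian_hx eps1 eps2 x h e i j r s). - by rewrite !fE. - by rewrite
    !fE.
- exact: (yangian_xex eps1 eps2 x h e i j r s). - by rewrite !fE. - by rewrite
    !fE.
- exact: (yangian_serre eps1 eps2 x h e r s nij). - by rewrite lrmorph_serre. -
    exact: rmorph0.
- exact: (yangian_odd eps1 eps2 x h e r s oi). - by rewrite !fE. - exact:
    rmorph0.
- exact: (yangian_quartic eps1 eps2 x h e r s oi). - by rewrite !fE. - exact:
    rmorph0.
Qed.

Lemma yangian_rel_image : (forall u v, yangian_rel eps1 eps2 x h u v ->
  f u = f v) ->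
  forall u v, yangian_rel eps1 eps2 fx fh u v -> u = v.
Proof. by move=> hold u v /yangian_rel_lift[u' [v' [/hold e <- <-]]]. Qed.

End YangianTransport.

Section MinimalTransport.
Context (x : bool -> 'I_(m + n) -> 'I_2 -> A) (h : 'I_(m + n) -> 'I_2 -> A).
Local Notation fx := (fun e i r => f (x e i r)).
Local Notation fh := (fun i r => f (h i r)).

Lemma lrmorph_htilde i : f (htilde1 eps1 eps2 h i) = htilde1 eps1 eps2 fh i.
Proof. by rewrite /htilde1 !fE. Qed.

Lemma minimal_rel_map u v : minimal_rel eps1 eps2 x h u v ->
  minimal_rel eps1 eps2 fx fh (f u) (f v).
Proof.
case=> [i j r s|i j|i j|i j|e i j r|e i j|e i j|e i j nij|e i oi|e i oi];
  rewrite ?fE ?lrmorph_htilde ?rmorph0.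
- exact: minimal_hh.
- exact: minimal_x0x0.
- exact: minimal_x1x0.
- exact: minimal_x0x1.
- exact: (minimal_h0x _ _ fx fh).
- exact: (minimal_h1x _ _ fx fh).
- exact: (minimal_xex _ _ fx fh).
- exact: (minimal_serre _ _ fx fh).
- exact: (minimal_odd _ _ fx fh).
- exact: (minimal_quartic _ _ fx fh).
Qed.

Lemma minimal_rel_lift u v : minimal_rel eps1 eps2 fx fh u v ->
  exists u' v', [/\ minimal_rel eps1 eps2 x h u' v', f u' = u & f v' = v].
Proof.
case=> [i j r s|i j|i j|i j|e i j r|e i j|e i j|e i j nij|e i oi|e i oi];
  do 2 eexists; split.
- exact: (minimal_hh eps1 eps2 x h i j r s). - by rewrite !fE. - exact: rmorph0.
- exact: (minimal_x0x0 eps1 eps2 x h i j). - by rewrite !fE. - by rewrite !fE.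
- exact: (minimal_x1x0 eps1 eps2 x h i j). - by rewrite !fE. - by rewrite !fE.
- exact: (minimal_x0x1 eps1 eps2 x h i j). - by rewrite !fE. - by rewrite !fE.
- exact: (minimal_h0x eps1 eps2 x h e i j r). - by rewrite !fE. - by rewrite
    !fE.
- exact: (minimal_h1x eps1 eps2 x h e i j). - by rewrite lrmorph_sbracket
    lrmorph_htilde. - by rewrite !fE.
- exact: (minimal_xex eps1 eps2 x h e i j). - by rewrite !fE. - by rewrite !fE.
- exact: (minimal_serre eps1 eps2 x h e nij). - by rewrite lrmorph_iter. -
    exact: rmorph0.
- exact: (minimal_odd eps1 eps2 x h e oi). - by rewrite !fE. - exact: rmorph0.
- exact: (minimal_quartic eps1 eps2 x h e oi). - by rewrite !fE. - exact:
    rmorph0.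
Qed.

Lemma minimal_rel_image : (forall u v, minimal_rel eps1 eps2 x h u v ->
  f u = f v) ->
  forall u v, minimal_rel eps1 eps2 fx fh u v -> u = v.
Proof. by move=> hold u v /minimal_rel_lift[u' [v' [/hold e <- <-]]]. Qed.

End MinimalTransport.

End Transport.

Section YangianFamily.
Context (K : fieldType) (char0 : [pchar K] =i pred0) (m n : nat) (eps1 eps2 :
  K).
Hypotheses (hm : (2 <= m)%N) (hn : (2 <= n)%N).
Context (A : superAlgType K).
Implicit Types (i j : 'I_(m + n)) (e : bool).
Local Notation a i j := ((cartan_a i j)%:~R : K).
Local Notation b i j := ((cartan_b i j)%:~R : K).
Local Notation sg e := ((-1) ^+ nat_of_bool e : K).
Local Notation epsD := ((eps1 + eps2) / 2).
Local Notation epsB := ((eps1 - eps2) / 2).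

Section Restriction.
Context (x : bool -> 'I_(m + n) -> nat -> A) (h : 'I_(m + n) -> nat -> A).
Hypothesis h_even : forall i r, even (h i r).
Hypothesis rel : forall u v, yangian_rel eps1 eps2 x h u v -> u = v.

Lemma yangian_htilde i e j s :
  ad (htilde1 eps1 eps2 (fun i (r : 'I_2) => h i r) i) (x e j s)
  = (sg e * a i j) *: (x e j s.+1 - (b i j * epsB) *: x e j s).
Proof.
have h0 r : ad (h i 0) (x e j r) = (sg e * a i j) *: x e j r.
  by rewrite -(sbracket_even _ (h_even i 0)); apply: rel; constructor.
have := rel (yangian_hx eps1 eps2 x h e i j 0 s).
rewrite !(sbracket_even _ (h_even i _)) !h0 => /eqP; rewrite subr_eq => /eqP h1.
rewrite /htilde1 expr2 adBl adZl adMl /= !h0 h1 /anticomm.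
by nc_ring K A.
Qed.

(** Only two cases differ in form: the relation of h~_{i,1}, and the Serre
    relation, where in degree zero all permutations contribute the same
    term. *)
Lemma yangian_minimal u v :
  minimal_rel eps1 eps2 (fun e i (r : 'I_2) => x e i r) (fun i (r : 'I_2) =>
    h i r) u v ->
  u = v.
Proof.
case=> {u v} [i j r s|i j|i j|i j|e i j r|e i j|e i j|e i j nij|e i oi|e i oi].
- by apply: rel; constructor.
- exact: (rel (yangian_xx eps1 eps2 x h i j 0 0)).
- exact: (rel (yangian_xx eps1 eps2 x h i j 1 0)).
- exact: (rel (yangian_xx eps1 eps2 x h i j 0 1)).
- exact: (rel (yangian_h0x eps1 eps2 x h e i j r)).
- rewrite sbracket_even ?yangian_htilde //.
  rewrite /htilde1 -scaleNr; apply/evenD/evenZ; first exact: h_even.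
  by rewrite expr2; apply: evenM; apply: h_even.
- exact: (rel (yangian_xex eps1 eps2 x h e i j 0 0)).
- have := rel (@yangian_serre _ _ _ eps1 eps2 _ x h e i j (fun=> 0%N) 0 nij).
  set N := (1 + _)%N => E.
  suff : (N`!%:R : K) *: iter N (sbracket (x e i 0)) (x e j 0) = 0.
    move/eqP; rewrite scaler_eq0 (natr_eq0_char0 char0) -[_ == 0%N]negbK -lt0n
      fact_gt0.
    by move/eqP.
  rewrite -[RHS]E sumr_const scaler_nat; congr (_ *+ _).
    have it (I : Type) (s : seq I) v :
        iter (size s) (sbracket (x e i 0)) v = foldr (fun=> sbracket (x e i 0))
          v s.
      by elim: s => //= k s ->.
    by rewrite -it size_enum_ord.
  by rewrite -card_Sn; apply: eq_card => w; rewrite !inE.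
- exact: (rel (@yangian_odd _ _ _ eps1 eps2 _ x h e i 0 0 oi)).
- exact: (rel (@yangian_quartic _ _ _ eps1 eps2 _ x h e i 0 0 oi)).
Qed.

End Restriction.

(** The degree is raised by h~_{i,1} for a neighbour i of the node, and the
    h_{i,r} are brackets of the other generators. *)
Lemma yangian_family_unique (x x' : bool -> 'I_(m + n) -> nat -> A)
    (h h' : 'I_(m + n) -> nat -> A) :
  (forall i r, even (h i r)) -> (forall i r, even (h' i r)) ->
  (forall u v, yangian_rel eps1 eps2 x h u v -> u = v) ->
  (forall u v, yangian_rel eps1 eps2 x' h' u v -> u = v) ->
  (forall e i, x e i 0 = x' e i 0) -> (forall i (r : 'I_2), h i r = h' i r) ->
  (forall e i r, x e i r = x' e i r) /\ (forall i r, h i r = h' i r).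
Proof.
move=> he he' rel rel' x0 h01.
have xE e j r : x e j r = x' e j r.
  elim: r => [|r IH]; first exact: x0.
  have nz : sg e * a (ordS j) j != 0.
    rewrite mulf_neq0 ?signr_eq0 // cartan_aC // cartan_a_next // rmorphN
      oppr_eq0.
    by rewrite /psign rmorphXn /= rmorphN rmorph1 signr_eq0.
  have E := yangian_htilde he rel (ordS j) e j r.
  have E' := yangian_htilde he' rel' (ordS j) e j r.
  have ht : htilde1 eps1 eps2 (fun i (r : 'I_2) => h i r) (ordS j)
      = htilde1 eps1 eps2 (fun i (r : 'I_2) => h' i r) (ordS j).
    by rewrite /htilde1 !h01.
  move: E; rewrite ht IH E' => /(scalerI nz) /addIr; exact: esym.
split=> // i r.
have := rel _ _ (yangian_xx eps1 eps2 x h i i r 0).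
have := rel' _ _ (yangian_xx eps1 eps2 x' h' i i r 0).
by rewrite !addn0 eqxx !mulr1n !xE => -> ->.
Qed.

End YangianFamily.

(** * The isomorphism *)

Section Isomorphism.
Context (K : fieldType) (char0 : [pchar K] =i pred0) (m n : nat) (eps1 eps2 :
  K).
Hypotheses (hm : (2 <= m)%N) (hn : (2 <= n)%N) (hmn : m <> n).

Section Presentation.
Context (L : choiceType) (P : relations (freeSuper K (@ygen_parity m n L))).
Local Notation Q := (superQuot P).
Local Notation xq := (fun e i r => quot_pi P (gen_x K e i r)).
Local Notation hq := (fun i r => quot_pi P (gen_h K i r)).

Lemma presented_x_par e i (r : L) : hcomp (odd_node i) (xq e i r) = xq e i r.
Proof. by rewrite -quot_pi_hcomp hcomp_gen eqxx. Qed.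

Lemma presented_h_even i (r : L) : even (hq i r).
Proof. by rewrite /even -quot_pi_hcomp hcomp_gen. Qed.

(** The hypothesis on P is quantified over the extension to the free
    superalgebra, so that the relations can be transported along it. *)
Lemma presented_ext (B : superAlgType K) (x : bool -> 'I_(m + n) -> L -> B)
    (h : 'I_(m + n) -> L -> B) :
  (forall e i r, hcomp (odd_node i) (x e i r) = x e i r) ->
  (forall i r, even (h i r)) ->
  (forall f : {lrmorphism freeSuper K (@ygen_parity m n L) -> B},
     (forall p u, f (hcomp p u) = hcomp p (f u)) ->
     (fun e i r => f (gen_x K e i r)) = x -> (fun i r => f (gen_h K i r)) = h ->
     forall u v, P u v -> f u = f v) ->
  exists g : {lrmorphism Q -> B},
    [/\ forall p u, g (hcomp p u) = hcomp p (g u),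
        forall e i r, g (xq e i r) = x e i r & forall i r, g (hq i r) = h i r].
Proof.
move=> xp hp respects.
pose val g := match g with YX e i r => x e i r | YH i r => h i r end.
have [|f [fv f_hcomp]] := @free_universal K _ (@ygen_parity m n L) B val.
  by case=> [e i r|i r]; [exact: xp|exact: hp].
have fx e i r : f (gen_x K e i r) = x e i r by rewrite fv.
have fh i r : f (gen_h K i r) = h i r by rewrite fv.
have [|g [gpi g_hcomp]] := @quot_universal K _ B P f f_hcomp.
  apply: (respects f f_hcomp).
  - by apply/funext => e; apply/funext => i; apply/funext => r.
  - by apply/funext => i; apply/funext => r.
by exists g; split=> // *; rewrite gpi.
Qed.

Lemma presented_ind (B : superAlgType K) (f1 f2 : {lrmorphism Q -> B}) :
  (forall e i r, f1 (xq e i r) = f2 (xq e i r)) ->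
  (forall i r, f1 (hq i r) = f2 (hq i r)) -> f1 =1 f2.
Proof.
move=> fx fh q; rewrite -[q]reprK; move: (repr q) => u {q}.
rewrite -[\pi_(superQuot P) u]/(quot_pi P u).
elim/free_ind: u => [|k u v IHu IHv|u v IHu IHv|[e i r|i r]].
- by rewrite !rmorph1.
- by rewrite !linearP /= IHu IHv.
- by rewrite !rmorphM /= IHu IHv.
- exact: fx.
- exact: fh.
Qed.

End Presentation.

(** The two maps fix the generators of degree at most one.  Their composition
    on the Yangian is the identity because the image of the extended family and
    the generators are two Yangian families that agree in these degrees. *)
Lemma yangian_isomorphic : superalg_isomorphic
  (affine_super_yangian m n eps1 eps2) (minimal_super_yangian m n eps1 eps2).
Proof.
pose PY := yangian_relations m n eps1 eps2.
pose PM := minimal_relations m n eps1 eps2.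
pose xY e i r := quot_pi PY (gen_x K e i r); pose hY i r :=
  quot_pi PY (gen_h K i r).
pose xM e i r := quot_pi PM (gen_x K e i r); pose hM i r :=
  quot_pi PM (gen_h K i r).
have relY u v : yangian_rel eps1 eps2 xY hY u v -> u = v.
  apply: (yangian_rel_image (quot_pi_hcomp PY) (x := @gen_x K m n nat)
    (h := @gen_h K m n nat)) => u' v' uv; exact: (@quot_pi_rel _ _ PY).
have relM u v : minimal_rel eps1 eps2 xM hM u v -> u = v.
  apply: (minimal_rel_image (quot_pi_hcomp PM) (x := @gen_x K m n 'I_2)
    (h := @gen_h K m n 'I_2)) => u' v' uv; exact: (@quot_pi_rel _ _ PM).
have [x' [h' [x'x h'h [xp hp] rel']]] := minimal_extends char0 hm hn hmn
  (presented_x_par PM) (presented_h_even PM) relM.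
have [|g [g_hcomp gx gh]] := @presented_ext _ PY _ x' h' xp hp.
  move=> f f_hcomp fx fh u v uv; apply: rel'.
  by rewrite -fx -fh; apply: yangian_rel_map.
have [|f [f_hcomp fx fh]] := @presented_ext _ PM _
  (fun e i (r : 'I_2) => xY e i r) (fun i (r : 'I_2) => hY i r)
  (fun e i r => presented_x_par PY e i r) (fun i r => presented_h_even PY i r).
  move=> f f_hcomp fx fh u v uv.
  apply: (yangian_minimal char0 (presented_h_even PY) relY).
  by rewrite -fx -fh; apply: minimal_rel_map.
have relfY : forall u v, yangian_rel eps1 eps2 (fun e i r => f (x' e i r))
    (fun i r => f (h' i r)) u v -> u = v.
  by apply: (yangian_rel_image f_hcomp) => u v /rel' ->.
have fh_even i r : even (f (h' i r)) by rewrite /even -f_hcomp hp.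
have [fx' fh'] : (forall e i r, f (x' e i r) = xY e i r)
    /\ (forall i r, f (h' i r) = hY i r).
  apply: (yangian_family_unique hm hn fh_even (presented_h_even PY) relfY relY).
  - by move=> e i; rewrite (x'x e i 0) fx.
  - by move=> i r; rewrite h'h fh.
exists g; split=> //; exists f.
  apply: (@presented_ind _ PY _ (f \o g) idfun) => [e i r|i r] /=.
    by rewrite gx fx'.
  by rewrite gh fh'.
apply: (@presented_ind _ PM _ (g \o f) idfun) => [e i r|i r] /=.
  by rewrite fx gx x'x.
by rewrite fh gh h'h.
Qed.

End Isomorphism.

Local Close Scope ring_scope.

Theorem theorem1p1 (R : realType) (m n : nat) (eps1 eps2 : complex R)
    (hm : 2 <= m) (hn : 2 <= n) (hmn : m <> n) :
  superalg_isomorphic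
    (affine_super_yangian m n eps1 eps2)
    (minimal_super_yangian m n eps1 eps2).
Proof. exact: (yangian_isomorphic (@Num.Theory.pchar_num _) _ _ hm hn hmn). Qed.
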